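(* Consider the sequence $X_t$ satisfying the backward recursion $$X_t=\Theta(X_{t+1}),\qquad X_T=\theta I .$$ For $c\in(0,\bar c]$, the sequence belongs to $\mathcal C=\{X\in\mathcal Q_n:\ \theta I\le X\le\Sigma_\rho\}$ and is nondecreasing (along the backward recursion, i.e. $X_t\ge X_{t+1}$). Thus, as $t\to-\infty$, $X_t$ converges to $X\in\mathcal C$ which is a solution of the algebraic Riccati equation $$X=\bar A^T(X^{-1}-\bar B\bar B^T)^{-1}\bar A+\theta I .$$
   Context: Notation. $\sigma(M)$ is the spectral radius of a square matrix $M$ (with $\sigma(M)^{-1}=+\infty$ if $\sigma(M)=0$); $M$ is stable if $\sigma(M)<1$. $\mathcal Q_n$ is the space of real symmetric $n\times n$ matrices, with the positive semidefinite order $\le$; $X>0$ means positive definite. $T$ is a finite terminal time, and the recursion runs over $t<T$. Robust filter. $A\in\mathbb R^{n\times n}$, $B\in\mathbb R^{n\times m}$, $C\in\mathbb R^{p\times n}$, $D\in\mathbb R^{p\times m}$, with $(A,B)$ reachable, $(A,C)$ observable, $BD^T=0$, $m=n+p$, and the stacked matrix $[B^T\ D^T]^T$ square and invertible. For a tolerance $c>0$ and $P_0>0$, put $V_0=P_0$ and for $t\ge0$ $$G_t=AV_tC^T(CV_tC^T+DD^T)^{-1},\quad P_{t+1}=A(V_t^{-1}+C^T(DD^T)^{-1}C)^{-1}A^T+BB^T,\quad V_{t+1}=(P_{t+1}^{-1}-\theta_tI)^{-1},$$ where $\theta_t>0$ (with $\theta_t<\sigma(P_{t+1})^{-1}$)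 is the unique solution of $c=\gamma(P_{t+1},\theta_t)$, with $\gamma(P,\theta)=\frac12\left[\log\det(I-\theta P)+\mathrm{tr}[(I-\theta P)^{-1}]-n\right]$. Known fact: there is $c_{MAX}>0$ such that for $c\in(0,c_{MAX}]$ and any $P_0>0$: $P_t\to P>0$, $\theta_t\to\theta>0$, $V_t\to V>0$, $G_t\to G$ with $A-GC$ stable, and $P$ is the unique solution of $P=A(P^{-1}-\theta I+C^T(DD^T)^{-1}C)^{-1}A^T+BB^T$. For $c\in(0,c_{MAX}]$ the symbols $\theta,P,V,G$ denote these limits, and $\bar A:=A-GC$ (stable), $\bar B:=B-GD$; $\bar B\bar B^T$ is invertible. $\bar A,\bar B$ depend on $c$ through $\theta$; for $\theta=0$ they are given by the same formulas with $P$ the solution of the Riccati equation for $\theta=0$ (standard Kalman filter, $V=P$). Standing assumption: for $\check\theta>0$ sufficiently small, the map $\theta\mapsto(\bar A,\bar B)$ is continuous on $[0,\check\theta]$. The map $\Theta$. For $0<X<(\bar B\bar B^T)^{-1}$, $\Theta(X):=\bar A^T(X^{-1}-\bar B\bar B^T)^{-1}\bar A+\theta I$. The matrix $\Sigma_\rho$ and the constant $\bar c$. For $\rho\in(1,\sigma(\bar A)^{-1})$, $\Sigma_\rho$ is the unique solution of the algebraic Lyapunov equation $\Sigma_\rho=\rho^2\bar A^T\Sigma_\rho\bar A+\theta I$. It is known that for $c\in(0,c_{MAX}]$ sufficiently small there exists $\rho\in(1,\sigma(\bar A)^{-1})$ such that $$(1-\rho^{-2})\Sigma_\rho^{-1}-\bar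 B\bar B^T\ge0. \qquad ( * )$$ $\bar c\in(0,c_{MAX}]$ is a value of $c$ for which this is the case, so that $( * )$ holds for a certain $\rho$ and the corresponding $\theta$. The authors then observe (as a claim, not as a condition imposed on $\bar c$) that for any $c\in(0,\bar c)$ inequality $( * )$ still holds with the same value of $\rho$ but with a smaller value of $\theta$. For $c\in(0,\bar c]$, $\Sigma_\rho$ is formed with this $\rho$ and with the $\theta,\bar A$ corresponding to $c$.
   Formalization: The claim fails for arbitrary c̄ and ρ satisfying ( * ) only at c̄; shown instead: some c̄ and ρ exist with ( * ) and the conclusion for all c∈(0,c̄], and the conclusion holds for every c∈(0,c_MAX] and every ρ∈(1,σ(Ā)^{-1}) satisfying ( * ) at c. *)

(* Defs.v *)
From HB Require Import structures.
From mathcomp Require Import all_boot all_order all_algebra.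
From mathcomp Require Import complex.
From mathcomp Require Import all_classical all_reals all_analysis.
Set Implicit Arguments.
Unset Strict Implicit.
Unset Printing Implicit Defensive.
Import Order.TTheory GRing.Theory Num.Theory.
Import numFieldNormedType.Exports.
Local Open Scope classical_set_scope.
Local Open Scope ring_scope.

Section Matrices.
Variable R : realType.

(* Maximum modulus of the complex eigenvalues. *)
Definition spectral_radius n (M : 'M[R]_n) : R :=
  sup [set ComplexField.Normc.normc z |
    z in [set z : R[i] | eigenvalue (map_mx (real_complex R) M) z]].

(* The inverse on \bar R satisfies 0^-1 = +oo. *)
Definition inv_spectral_radius n (M : 'M[R]_n) : \bar R :=
  ((spectral_radius M)%:E^-1)%E.

Definition stable n (M : 'M[R]_n) : Prop := spectral_radius M < 1.

Definition psdmx n (M : 'M[R]_n) : Prop :=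
  M^T = M /\ forall v : 'cV[R]_n, 0 <= (v^T *m M *m v) 0 0.

Definition pdmx n (M : 'M[R]_n) : Prop :=
  M^T = M /\ forall v : 'cV[R]_n, v != 0 -> 0 < (v^T *m M *m v) 0 0.

(* The Loewner orders on symmetric matrices. *)
Definition loewner_le n (X Y : 'M[R]_n) : Prop := psdmx (Y - X).
Definition loewner_lt n (X Y : 'M[R]_n) : Prop := pdmx (Y - X).

Definition reachable n m (A : 'M[R]_n) (B : 'M[R]_(n, m)) : Prop :=
  \rank (\mxrow_(i < n) (A ^+ i *m B)) = n.

Definition observable n p (A : 'M[R]_n) (C : 'M[R]_(p, n)) : Prop :=
  \rank (\mxcol_(i < n) (C *m A ^+ i)) = n.

End Matrices.

Section RobustFilter.
Variables (R : realType) (n p : nat).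
Variables (A : 'M[R]_n) (B : 'M[R]_(n, n + p)).
Variables (C : 'M[R]_(p, n)) (D : 'M[R]_(p, n + p)).

Definition gamma (P : 'M[R]_n) (theta : R) : R :=
  (ln (\det (1%:M - theta *: P)) + \tr (invmx (1%:M - theta *: P)) - n%:R) / 2.

Definition filter_gain (V : 'M[R]_n) : 'M[R]_(n, p) :=
  A *m V *m C^T *m invmx (C *m V *m C^T + D *m D^T).

Definition risk_parameter (c : R) (P : 'M[R]_n) (theta : R) : Prop :=
  [/\ 0 < theta, (theta%:E < inv_spectral_radius P)%E & c = gamma P theta].

Definition robust_filter (c : R) (P0 : 'M[R]_n) (P V : nat -> 'M[R]_n)
    (G : nat -> 'M[R]_(n, p)) (theta : nat -> R) : Prop :=
  [/\ P 0%N = P0, V 0%N = P0 &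
    forall t : nat,
      [/\ G t = filter_gain (V t),
          P t.+1 = A *m invmx (invmx (V t) + C^T *m invmx (D *m D^T) *m C)
                     *m A^T + B *m B^T,
          unique (risk_parameter c (P t.+1)) (theta t) &
          V t.+1 = invmx (invmx (P t.+1) - (theta t)%:M)]].

(* The condition on P^-1 - theta I says that V = (P^-1 - theta I)^-1 > 0. *)
Definition riccati_solution (theta : R) (P : 'M[R]_n) : Prop :=
  [/\ pdmx P, pdmx (invmx P - theta%:M) &
      P = A *m invmx (invmx P - theta%:M + C^T *m invmx (D *m D^T) *m C)
            *m A^T + B *m B^T].

(* For tolerance c the filter, from any P0 > 0, converges to (P, V, G, theta).
   The trajectory from P0 is unique, so asserting a converging one is the same
   as asserting that the trajectory exists and converges. *)
Definition filter_limits (c : R) (P V : 'M[R]_n) (G : 'M[R]_(n, p))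
    (theta : R) : Prop :=
  [/\ pdmx P, pdmx V, 0 < theta & stable (A - G *m C)] /\
  unique (riccati_solution theta) P /\
  (forall P0 : 'M[R]_n, pdmx P0 ->
    exists Pt Vt Gt thetat, robust_filter c P0 Pt Vt Gt thetat /\
      [/\ Pt @ \oo --> P, Vt @ \oo --> V, Gt @ \oo --> G &
          thetat @ \oo --> theta]).

Definition closed_loop_A (G : 'M[R]_(n, p)) : 'M[R]_n := A - G *m C.
Definition closed_loop_B (G : 'M[R]_(n, p)) : 'M[R]_(n, n + p) := B - G *m D.

Definition gain_of_riccati (theta : R) (P : 'M[R]_n) : 'M[R]_(n, p) :=
  filter_gain (invmx (invmx P - theta%:M)).

(* Psol theta is the Riccati solution that defines (Abar, Bbar) at theta; at
   theta = 0 it is the one of the standard Kalman filter. *)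
Definition closed_loop_continuous (thetac : R) (Psol : R -> 'M[R]_n) : Prop :=
  [/\ forall theta, 0 <= theta <= thetac -> riccati_solution theta (Psol theta),
      {within `[0, thetac], continuous
         (fun theta => closed_loop_A (gain_of_riccati theta (Psol theta)))} &
      {within `[0, thetac], continuous
         (fun theta => closed_loop_B (gain_of_riccati theta (Psol theta)))}].

End RobustFilter.

Section BackwardRecursion.
Variables (R : realType) (n m : nat).
Variables (Abar : 'M[R]_n) (Bbar : 'M[R]_(n, m)) (theta : R).

Definition Theta_domain (X : 'M[R]_n) : Prop :=
  pdmx X /\ loewner_lt X (invmx (Bbar *m Bbar^T)).

(* Only meaningful on Theta_domain. *)
Definition Theta (X : 'M[R]_n) : 'M[R]_n :=
  Abar^T *m invmx (invmx X - Bbar *m Bbar^T) *m Abar + theta%:M.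

(* For 1 < rho < 1 / spectral_radius Abar the equation has exactly one
   solution; outside that range the value is not used. *)
Definition Sigma (rho : R) : 'M[R]_n :=
  xget 0 [set S | S = rho ^+ 2 *: (Abar^T *m S *m Abar) + theta%:M].

Definition admissible_rho (rho : R) : Prop :=
  [/\ 1 < rho, (rho%:E < inv_spectral_radius Abar)%E &
      loewner_le 0 ((1 - rho ^- 2) *: invmx (Sigma rho) - Bbar *m Bbar^T)].

Definition order_interval (rho : R) (X : 'M[R]_n) : Prop :=
  [/\ X^T = X, loewner_le theta%:M X & loewner_le X (Sigma rho)].

(* The terms and the limit are also required to lie in the domain of Theta, so
   that neither the recursion nor the limit equation relies on junk values of
   invmx. *)
Definition backward_convergence (rho : R) : Prop :=
  forall (T : int) (X : int -> 'M[R]_n),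
    X T = theta%:M ->
    (forall t : int, t < T -> X t = Theta (X (t + 1))) ->
    [/\ forall t : int, t <= T -> Theta_domain (X t) /\ order_interval rho (X t),
        forall t : int, t < T -> loewner_le (X (t + 1)) (X t) &
        exists Xlim : 'M[R]_n,
          [/\ (fun k : nat => X (T - k%:Z)) @ \oo --> Xlim,
              order_interval rho Xlim, Theta_domain Xlim &
              Xlim = Theta Xlim]].

End BackwardRecursion.

(* Main.v *)
Require Import Defs.
From HB Require Import structures.
From mathcomp Require Import all_boot all_order all_algebra.
From mathcomp Require Import complex ring lra.
From mathcomp Require Import all_classical all_reals all_analysis.
Set Implicit Arguments.
Unset Strict Implicit.
Unset Printing Implicit Defensive.
Import Order.TTheory GRing.Theory Num.Theory.
Import numFieldNormedType.Exports.
Local Open Scope classical_set_scope.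
Local Open Scope ring_scope.

(* Write N = Bbar Bbar^T and Sigma = Sigma_rho.  By the inequality defining rho,
   Sigma^-1 - N >= rho^-2 Sigma^-1 > 0, so for theta I <= X <= Sigma the resolvent
   (X^-1 - N)^-1 is defined, positive, monotone in X and at most rho^2 Sigma; hence
   Theta maps the order interval to itself monotonically, and the backward iterates
   of theta I increase to a fixed point.

   Existence of a common rho for all small c: at theta = 0 the Joseph form
   P = Abar P Abar^T + N of the Riccati equation, with N >= B B^T > 0, shows that
   Abar contracts P by a factor r^-2 with r > 1; by duality W = P^-1 satisfies
   r^2 Abar^T W Abar <= W, and by continuity this persists, with a smaller r, for
   small theta.  Comparing Lyapunov equations, Sigma_rho is at most a multiple of
   theta W, which yields the inequality for rho as soon as theta is small.  Finally
   theta -> 0 when c -> 0: with M = (I - theta P)^-1, Hadamard's inequality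
   det M <= prod_i M_ii gives
   2 c = 2 gamma(P, theta) >= x - ln (1 + x) for x = theta (B B^T)_kk. *)

(** * Bilinear forms of real matrices *)

Section Forms.
Variable R : realType.
Implicit Types n m k : nat.

Definition bform n m (M : 'M[R]_(n, m)) (u : 'cV[R]_n) (v : 'cV[R]_m) : R :=
  (u^T *m M *m v) 0 0.

Lemma bformDm n m (M N : 'M[R]_(n, m)) u v :
  bform (M + N) u v = bform M u v + bform N u v.
Proof. by rewrite /bform mulmxDr mulmxDl mxE. Qed.

Lemma bformNm n m (M : 'M[R]_(n, m)) u v : bform (- M) u v = - bform M u v.
Proof. by rewrite /bform mulmxN mulNmx mxE. Qed.

Lemma bformBm n m (M N : 'M[R]_(n, m)) u v :
  bform (M - N) u v = bform M u v - bform N u v.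
Proof. by rewrite bformDm bformNm. Qed.

Lemma bformZm n m a (M : 'M[R]_(n, m)) u v : bform (a *: M) u v = a * bform M u v.
Proof. by rewrite /bform -scalemxAr -scalemxAl mxE. Qed.

Lemma bform_scalar n a (u v : 'cV[R]_n) : bform a%:M u v = a * bform 1%:M u v.
Proof. by rewrite -bformZm scalemx1. Qed.

Lemma bformDl n m (M : 'M[R]_(n, m)) u1 u2 v :
  bform M (u1 + u2) v = bform M u1 v + bform M u2 v.
Proof. by rewrite /bform linearD/= !mulmxDl mxE. Qed.

Lemma bformDr n m (M : 'M[R]_(n, m)) u v1 v2 :
  bform M u (v1 + v2) = bform M u v1 + bform M u v2.
Proof. by rewrite /bform mulmxDr mxE. Qed.

Lemma bformNl n m (M : 'M[R]_(n, m)) u v : bform M (- u) v = - bform M u v.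
Proof. by rewrite /bform linearN/= !mulNmx mxE. Qed.

Lemma bformNr n m (M : 'M[R]_(n, m)) u v : bform M u (- v) = - bform M u v.
Proof. by rewrite /bform mulmxN mxE. Qed.

Lemma bformZl n m (M : 'M[R]_(n, m)) a u v : bform M (a *: u) v = a * bform M u v.
Proof. by rewrite /bform linearZ/= -!scalemxAl mxE. Qed.

Lemma bformZr n m (M : 'M[R]_(n, m)) a u v : bform M u (a *: v) = a * bform M u v.
Proof. by rewrite /bform -scalemxAr mxE. Qed.

Definition bformL := (bformDl, bformDr, bformNl, bformNr, bformZl, bformZr).

Lemma bform_tr n m (M : 'M[R]_(n, m)) u v : bform M^T v u = bform M u v.
Proof.
have -> : bform M u v = (u^T *m M *m v)^T 0 0 by rewrite mxE.
by rewrite !trmx_mul trmxK mulmxA.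
Qed.

Lemma bformC n (M : 'M[R]_n) u v : M^T = M -> bform M u v = bform M v u.
Proof. by move=> h; rewrite -bform_tr h. Qed.

Lemma bform_mull n m k (M : 'M[R]_(n, m)) (A : 'M[R]_(n, k)) u v :
  bform M (A *m u) v = bform (A^T *m M) u v.
Proof. by rewrite /bform trmx_mul !mulmxA. Qed.

Lemma bform_mulr n m k (M : 'M[R]_(n, m)) (A : 'M[R]_(m, k)) u v :
  bform M u (A *m v) = bform (M *m A) u v.
Proof. by rewrite /bform !mulmxA. Qed.

Lemma bform_delta n m (M : 'M[R]_(n, m)) i j :
  bform M (delta_mx i 0) (delta_mx j 0) = M i j.
Proof. by rewrite /bform trmx_delta -rowE -colE !mxE. Qed.

Lemma bform_sum n m (M : 'M[R]_(n, m)) u v :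
  bform M u v = \sum_i \sum_j u i 0 * M i j * v j 0.
Proof.
rewrite /bform mxE exchange_big; apply: eq_bigr => j _ /=.
rewrite mxE mulr_suml; apply: eq_bigr => i _; by rewrite mxE.
Qed.

Lemma bform1E n (v : 'cV[R]_n) : bform 1%:M v v = \sum_i v i 0 ^+ 2.
Proof.
rewrite /bform mulmx1 mxE; apply: eq_bigr => i _; by rewrite mxE expr2.
Qed.

Lemma bform1_ge0 n (v : 'cV[R]_n) : 0 <= bform 1%:M v v.
Proof. by rewrite bform1E sumr_ge0// => i _; exact: sqr_ge0. Qed.

Lemma bform1_gt0 n (v : 'cV[R]_n) : v != 0 -> 0 < bform 1%:M v v.
Proof.
move=> v0; rewrite lt_neqAle bform1_ge0 andbT eq_sym bform1E psumr_neq0; last first.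
  by move=> i _; exact: sqr_ge0.
apply: contraNT v0 => /hasPn h; apply/eqP/matrixP => i j; rewrite ord1 mxE.
have /= := h i (mem_index_enum _); rewrite -leNgt => hi.
by apply/eqP; rewrite -sqrf_eq0 eq_le hi sqr_ge0.
Qed.

Lemma le_coord_form1 n (v : 'cV[R]_n) i : v i 0 ^+ 2 <= bform 1%:M v v.
Proof.
rewrite bform1E (bigD1 i)//= lerDl sumr_ge0// => j _; exact: sqr_ge0.
Qed.

(** A crude substitute for the operator norm: it bounds quadratic forms and depends continuously on
    the entries. *)
Definition abs_sum n m (M : 'M[R]_(n, m)) : R := \sum_i \sum_j `|M i j|.

Lemma abs_sum_ge0 n m (M : 'M[R]_(n, m)) : 0 <= abs_sum M.
Proof. by do 2!(apply: sumr_ge0 => ? _). Qed.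

Lemma bform_le_abs_sum n (M : 'M[R]_n) v :
  `|bform M v v| <= abs_sum M * bform 1%:M v v.
Proof.
rewrite bform_sum /abs_sum mulr_suml (le_trans (ler_norm_sum _ _ _))//.
apply: ler_sum => i _; rewrite mulr_suml (le_trans (ler_norm_sum _ _ _))//.
apply: ler_sum => j _; rewrite mulrAC normrM mulrC ler_wpM2l//.
(* Both [v i 0 ^+ 2] and [v j 0 ^+ 2] are at most the squared norm of v, hence so is the modulus of
   the product of the two coordinates. *)
have hi := le_coord_form1 v i; have hj := le_coord_form1 v j.
rewrite ler_norml; apply/andP; split; nra.
Qed.

End Forms.

(** * The Loewner order: inversion, duality and perturbation *)

Section Loewner.
Variable R : realType.
Implicit Types n m k : nat.

Lemma psd_bform n (M : 'M[R]_n) v : psdmx M -> 0 <= bform M v v.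
Proof. by case=> _; exact. Qed.

Lemma pd_bform n (M : 'M[R]_n) v : pdmx M -> v != 0 -> 0 < bform M v v.
Proof. by case=> _; exact. Qed.

Lemma pdmx_psd n (M : 'M[R]_n) : pdmx M -> psdmx M.
Proof.
case=> hs h; split=> // v; have [->|/h/ltW//] := eqVneq v 0.
by rewrite mulmx0 mxE.
Qed.

Lemma loewner_leP n (X Y : 'M[R]_n) : X^T = X -> Y^T = Y ->
  (forall v, bform X v v <= bform Y v v) <-> loewner_le X Y.
Proof.
move=> hX hY; split=> [h|[_ h] v].
  split; first by rewrite linearB/= hX hY.
  by move=> v; have := h v; rewrite -subr_ge0 -bformBm.
by rewrite -subr_ge0 -bformBm; exact: h.
Qed.

Lemma loewner_le_bform n (X Y : 'M[R]_n) v :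
  loewner_le X Y -> bform X v v <= bform Y v v.
Proof. by case=> _ /(_ v); rewrite -[X in 0 <= X]/(bform _ _ _) bformBm subr_ge0. Qed.

Lemma loewner_le_refl n (X : 'M[R]_n) : loewner_le X X.
Proof.
split; first by rewrite subrr trmx0.
by move=> v; rewrite -[X in 0 <= X]/(bform _ _ _) bformBm subrr.
Qed.

Lemma loewner_le_trans n (Y X Z : 'M[R]_n) :
  loewner_le X Y -> loewner_le Y Z -> loewner_le X Z.
Proof.
move=> [s1 h1] [s2 h2]; split.
  by rewrite -(subrK Y Z) -addrA linearD/= s1 s2.
move=> v; rewrite -[X in 0 <= X]/(bform _ _ _) -(subrK Y Z) -addrA bformDm.
by apply: addr_ge0; [exact: h2|exact: h1].
Qed.

Lemma psdmx_le n (X Y : 'M[R]_n) : psdmx X -> loewner_le X Y -> psdmx Y.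
Proof.
move=> [s1 h1] [s2 h2]; split; first by rewrite -(subrK X Y) linearD/= s1 s2.
move=> v; rewrite -[X in 0 <= X]/(bform _ _ _) -(subrK X Y) bformDm.
by apply: addr_ge0; [exact: h2|exact: h1].
Qed.

Lemma pdmx_le n (X Y : 'M[R]_n) : pdmx X -> loewner_le X Y -> pdmx Y.
Proof.
move=> [s1 h1] [s2 h2]; split; first by rewrite -(subrK X Y) linearD/= s1 s2.
move=> v v0; rewrite -[X in 0 < X]/(bform _ _ _) -(subrK X Y) bformDm.
by apply: ltr_wpDl; [exact: h2|exact: h1].
Qed.

Lemma loewner_leDl n (X Y : 'M[R]_n) : loewner_le X (X + Y) <-> psdmx Y.
Proof. by rewrite /loewner_le addrC addrA addNr add0r. Qed.

Lemma psdmx_scalar n (a : R) : 0 <= a -> psdmx (a%:M : 'M[R]_n).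
Proof.
move=> a0; split; first exact: tr_scalar_mx.
move=> v; rewrite -[X in 0 <= X]/(bform _ _ _) bform_scalar.
by rewrite mulr_ge0// bform1_ge0.
Qed.

Lemma pdmx_scalar n (a : R) : 0 < a -> pdmx (a%:M : 'M[R]_n).
Proof.
move=> a0; split; first exact: tr_scalar_mx.
move=> v v0; rewrite -[X in 0 < X]/(bform _ _ _) bform_scalar.
by rewrite mulr_gt0// bform1_gt0.
Qed.

Lemma psdmxD n (X Y : 'M[R]_n) : psdmx X -> psdmx Y -> psdmx (X + Y).
Proof. by move=> hX hY; apply: psdmx_le hX _; exact/loewner_leDl. Qed.

Lemma pdmxD n (X Y : 'M[R]_n) : pdmx X -> psdmx Y -> pdmx (X + Y).
Proof. by move=> hX hY; apply: pdmx_le hX _; exact/loewner_leDl. Qed.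

Lemma psdmxZ n a (X : 'M[R]_n) : 0 <= a -> psdmx X -> psdmx (a *: X).
Proof.
move=> a0 [s h]; split; first by rewrite linearZ/= s.
by move=> v; rewrite -[X in 0 <= X]/(bform _ _ _) bformZm mulr_ge0//; exact: h.
Qed.

Lemma pdmxZ n a (X : 'M[R]_n) : 0 < a -> pdmx X -> pdmx (a *: X).
Proof.
move=> a0 [s h]; split; first by rewrite linearZ/= s.
move=> v v0; rewrite -[X in 0 < X]/(bform _ _ _) bformZm mulr_gt0//; exact: h.
Qed.

Lemma psdmx_congr n m (X : 'M[R]_n) (M : 'M[R]_(n, m)) :
  psdmx X -> psdmx (M^T *m X *m M).
Proof.
move=> [s h]; split; first by rewrite !trmx_mul trmxK s mulmxA.
move=> v; rewrite -[X in 0 <= X]/(bform _ _ _) -bform_mulr -bform_mull; exact: h.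
Qed.

Lemma loewner_le_congr n m (X Y : 'M[R]_n) (M : 'M[R]_(n, m)) :
  loewner_le X Y -> loewner_le (M^T *m X *m M) (M^T *m Y *m M).
Proof. by move/(psdmx_congr M); rewrite /loewner_le mulmxBr mulmxBl. Qed.

Lemma loewner_le_add2r n (Z X Y : 'M[R]_n) :
  loewner_le X Y -> loewner_le (X + Z) (Y + Z).
Proof. by rewrite /loewner_le opprD addrACA subrr addr0. Qed.

Lemma loewner_leZ n a (X Y : 'M[R]_n) : 0 <= a ->
  loewner_le X Y -> loewner_le (a *: X) (a *: Y).
Proof. by move=> a0; rewrite /loewner_le -scalerBr; exact: psdmxZ. Qed.

Lemma pdmx_unit n (M : 'M[R]_n) : pdmx M -> M \in unitmx.
Proof.
move=> hM; rewrite -row_free_unit -kermx_eq0; apply/rowV0P => v /sub_kermxP vM.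
apply/eqP; apply: contraT => v0.
have : 0 < bform M v^T v^T by apply: pd_bform => //; rewrite trmx_eq0.
by rewrite /bform trmxK vM mul0mx mxE ltxx.
Qed.

Lemma trmx_invmx n (M : 'M[R]_n) : M^T = M -> (invmx M)^T = invmx M.
Proof. by move=> h; rewrite trmx_inv h. Qed.

Lemma pdmx_inv n (M : 'M[R]_n) : pdmx M -> pdmx (invmx M).
Proof.
move=> hM; have uM := pdmx_unit hM; have sM := hM.1.
split; first exact: trmx_invmx.
move=> v v0; have -> : v = M *m (invmx M *m v) by rewrite mulKVmx.
set w := invmx M *m v; have w0 : w != 0.
  by apply: contraNneq v0 => w0; rewrite -(mulKVmx uM v) -/w w0 mulmx0.
rewrite trmx_mul sM -mulmxA -mulmxA mulKmx// mulmxA; exact: (pd_bform hM w0).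
Qed.

(* For X > 0 the form of X^-1 at v is the maximum of [2 w^T v - w^T X w]. *)
Lemma bform_inv_ge n (X : 'M[R]_n) v w : pdmx X ->
  2 * bform 1%:M w v - bform X w w <= bform (invmx X) v v.
Proof.
move=> hX; have uX := pdmx_unit hX; have sX := hX.1.
rewrite -subr_ge0; have := psd_bform (invmx X *m v - w) (pdmx_psd hX).
rewrite !bformL !bform_mulr !bform_mull trmx_invmx// mulmxV// mulVmx// ?mulmx1 ?mul1mx.
rewrite (bformC v w) ?trmx1//; lra.
Qed.

(** In the variational bound for [invmx X] at v, the test vector w = Y^-1 v gives 2 v^T w - w^T X w,
    which is at least v^T w because X <= Y and w^T Y w = v^T w. *)
Lemma loewner_le_inv n (X Y : 'M[R]_n) : pdmx X -> loewner_le X Y ->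
  loewner_le (invmx Y) (invmx X).
Proof.
move=> hX hXY; have hY := pdmx_le hX hXY; have uY := pdmx_unit hY.
apply/loewner_leP; [exact: trmx_invmx hY.1|exact: trmx_invmx hX.1|move=> v].
apply: le_trans (bform_inv_ge v (invmx Y *m v) hX).
have := loewner_le_bform (invmx Y *m v) hXY.
rewrite !bform_mulr !bform_mull trmx_invmx ?hY.1// mulmxV// !mulmx1; lra.
Qed.

(** The vector w = P^-1 M v serves twice. With q = v^T M^T P^-1 M v, the hypothesis at w bounds the
    form of P at M^T w by q, and the variational bound at v with test vector M^T w then gives 2 q -
    q <= v^T P^-1 v. *)
Lemma loewner_le_dual n (P M : 'M[R]_n) : pdmx P ->
  loewner_le (M *m P *m M^T) P -> loewner_le (M^T *m invmx P *m M) (invmx P).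
Proof.
move=> hP h; have uP := pdmx_unit hP; have sP := hP.1.
have sPi := trmx_invmx sP.
apply/loewner_leP; [by rewrite !trmx_mul sPi trmxK mulmxA|exact: sPi|move=> v].
pose w := invmx P *m (M *m v).
have e1 : bform (M^T *m invmx P *m M) v v = bform 1%:M (M^T *m w) v.
  by rewrite bform_mull mulmx1 trmxK /w !bform_mull sPi mulmxA.
have e2 : bform P w w = bform (M^T *m invmx P *m M) v v.
  by rewrite /w !bform_mull !bform_mulr sPi mulVmx// ?mulmx1.
have := loewner_le_bform w h; rewrite e2.
have -> : bform (M *m P *m M^T) w w = bform P (M^T *m w) (M^T *m w).
  by rewrite bform_mull bform_mulr trmxK.
have := bform_inv_ge v (M^T *m w) hP; rewrite -e1; lra.
Qed.

Lemma loewner_le_abs_sum n (M : 'M[R]_n) : M^T = M ->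
  loewner_le M (abs_sum M)%:M.
Proof.
move=> sM; apply/loewner_leP => // [|v]; first exact: tr_scalar_mx.
rewrite bform_scalar; apply: le_trans (bform_le_abs_sum M v); exact: ler_norm.
Qed.

Lemma invmx_scalar_mx n (a : R) : a != 0 -> invmx (a%:M : 'M[R]_n) = (a^-1)%:M.
Proof.
move=> a0; have u : (a%:M : 'M[R]_n) \in unitmx.
  by rewrite unitmxE det_scalar unitrX// unitfE.
by rewrite -[RHS](mulKmx u) -scalar_mxM divff// mulmx1.
Qed.

(** The constant comes from inverting a scalar upper bound of [invmx M]; the summand 1 keeps that
    bound positive in dimension 0 as well. *)
Lemma pdmx_lower n (M : 'M[R]_n) : pdmx M ->
  exists2 a, 0 < a & loewner_le a%:M M.
Proof.
move=> hM; have hI := pdmx_inv hM; set b := 1 + abs_sum (invmx M).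
have b0 : 0 < b by rewrite ltr_pwDl// abs_sum_ge0.
exists b^-1; first by rewrite invr_gt0.
have h : loewner_le (invmx M) b%:M.
  apply: loewner_le_trans (loewner_le_abs_sum hI.1) _.
  rewrite /loewner_le -raddfB/= /b addrK; exact: psdmx_scalar.
by have := loewner_le_inv hI h; rewrite invmxK invmx_scalar_mx ?gt_eqF.
Qed.

(** Replacing M by N changes the form at v by at most [abs_sum (N - M)] times the squared norm,
    which the margin a absorbs. *)
Lemma psdmx_near n (M N : 'M[R]_n) a : loewner_le a%:M M -> N^T = N ->
  abs_sum (N - M) <= a -> psdmx N.
Proof.
move=> h sN hK; split=> // v; rewrite -[X in 0 <= X]/(bform _ _ _).
have := loewner_le_bform v h; rewrite bform_scalar => h1.
have := bform_le_abs_sum (N - M) v; rewrite bformBm ler_norml => /andP[h2 _].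
have := ler_wpM2r (bform1_ge0 v) hK; lra.
Qed.

Lemma pdmx_congr n m (X : 'M[R]_n) (M : 'M[R]_(n, m)) :
  (forall v : 'cV[R]_m, M *m v = 0 -> v = 0) -> pdmx X ->
  pdmx (M^T *m X *m M).
Proof.
move=> hM hX; split; first by have [] := psdmx_congr M (pdmx_psd hX).
move=> v v0; rewrite -[X in 0 < X]/(bform _ _ _) -bform_mulr -bform_mull.
by apply: pd_bform => //; apply: contra_neq v0; exact: hM.
Qed.

Lemma pdmx_gram n m (M : 'M[R]_(n, m)) :
  (forall v : 'rV[R]_n, v *m M = 0 -> v = 0) -> pdmx (M *m M^T).
Proof.
move=> hM; have := @pdmx_congr m n 1%:M M^T.
rewrite trmxK mulmx1; apply; last exact: pdmx_scalar.
move=> v Mv; apply: trmx_inj; rewrite trmx0; apply: hM.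
by apply: trmx_inj; rewrite trmx_mul trmxK Mv trmx0.
Qed.

Lemma loewner_leD n (X1 X2 Y1 Y2 : 'M[R]_n) :
  loewner_le X1 Y1 -> loewner_le X2 Y2 -> loewner_le (X1 + X2) (Y1 + Y2).
Proof. by move=> h1 h2; rewrite /loewner_le opprD addrACA; exact: psdmxD. Qed.

End Loewner.

(** * Limits of matrix expressions along a filter *)

Section MatrixLimits.
Variables (R : realType) (T : Type) (F : set_system T).
Context {FF : Filter F}.

Lemma cvg_mx n m (f : T -> 'M[R]_(n, m)) (M : 'M[R]_(n, m)) :
  (forall i j, f t i j @[t --> F] --> M i j) -> f @ F --> M.
Proof.
move=> h; apply/cvg_ballP => e e0; near=> t; split=> //; near: t.
apply: filter_forall => i; apply: filter_forall => j.
by have /cvg_ballP/(_ e e0) := h i j.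
Unshelve. all: by end_near. Qed.

Lemma cvg_mx_coord n m (f : T -> 'M[R]_(n, m)) (M : 'M[R]_(n, m)) i j :
  f @ F --> M -> f t i j @[t --> F] --> M i j.
Proof.
exact: (continuous_cvg FF (h := fun N : 'M[R]_(n, m) => N i j)
  (@coord_continuous _ _ _ i j M)).
Qed.

Lemma cvg_sum_fin (I : finType) (f : I -> T -> R) (l : I -> R) :
  (forall i, f i t @[t --> F] --> l i) ->
  \sum_i f i t @[t --> F] --> \sum_i l i.
Proof.
move=> h; exact: (cvg_big (@pseudometric_normed_Zmodule.add_continuous _ R)).
Qed.

Lemma cvg_prod_fin (I : finType) (f : I -> T -> R) (l : I -> R) :
  (forall i, f i t @[t --> F] --> l i) ->
  \prod_i f i t @[t --> F] --> \prod_i l i.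
Proof. by move=> h; exact: (cvg_big (@mul_continuous R)). Qed.

Lemma cvg_mulmx n m k (f : T -> 'M[R]_(n, m)) (g : T -> 'M[R]_(m, k))
    (M : 'M[R]_(n, m)) (N : 'M[R]_(m, k)) :
  f @ F --> M -> g @ F --> N -> f t *m g t @[t --> F] --> M *m N.
Proof.
move=> hf hg; apply: cvg_mx => i j; rewrite mxE.
under eq_fun do rewrite mxE.
by apply: cvg_sum_fin => l; apply: cvgM; exact: cvg_mx_coord.
Qed.

Lemma cvg_trmx n m (f : T -> 'M[R]_(n, m)) (M : 'M[R]_(n, m)) :
  f @ F --> M -> (f t)^T @[t --> F] --> M^T.
Proof.
move=> hf; apply: cvg_mx => i j; rewrite mxE.
by under eq_fun do rewrite mxE; exact: cvg_mx_coord.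
Qed.

Lemma cvg_scalar_mx n (f : T -> R) a :
  f @ F --> a -> (f t)%:M @[t --> F] --> (a%:M : 'M[R]_n).
Proof.
move=> hf; apply: cvg_mx => i j; rewrite mxE.
under eq_fun do rewrite mxE.
by case: (i == j); rewrite /= ?mulr1n ?mulr0n//; exact: cvg_cst.
Qed.

Lemma cvg_det n (f : T -> 'M[R]_n) (M : 'M[R]_n) :
  f @ F --> M -> \det (f t) @[t --> F] --> \det M.
Proof.
move=> hf; apply: cvg_sum_fin => s; apply: cvgM; first exact: cvg_cst.
by apply: cvg_prod_fin => i; exact: cvg_mx_coord.
Qed.

Lemma cvg_trace n (f : T -> 'M[R]_n) (M : 'M[R]_n) :
  f @ F --> M -> \tr (f t) @[t --> F] --> \tr M.
Proof. by move=> hf; apply: cvg_sum_fin => i; exact: cvg_mx_coord. Qed.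

Lemma cvg_invmx n (f : T -> 'M[R]_n) (M : 'M[R]_n) : M \in unitmx ->
  f @ F --> M -> invmx (f t) @[t --> F] --> invmx M.
Proof.
move=> uM hf.
have hadj : \adj (f t) @[t --> F] --> \adj M.
  apply: cvg_mx => i j; rewrite mxE; under eq_fun do rewrite mxE.
  apply: cvgM; first exact: cvg_cst.
  apply: cvg_det; apply: cvg_mx => k l; rewrite !mxE.
  by under eq_fun do rewrite !mxE; exact: cvg_mx_coord.
have hdet := cvg_det hf.
have dM : \det M != 0 by rewrite -unitfE -unitmxE.
rewrite {2}/invmx uM.
(* [invmx] is given by the adjugate formula only on invertible matrices; near the limit the
   determinant is nonzero, so the two functions eventually coincide. *)
apply: (@cvg_trans _ ((fun t => (\det (f t))^-1 *: \adj (f t)) @ F)); last first.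
  by apply: cvgZ => //; exact: cvgV.
apply: near_eq_cvg; near=> t; rewrite /invmx unitmxE unitfE ifT//.
near: t; by apply: cvgr_neq0 dM.
Unshelve. all: by end_near. Qed.

Lemma cvg_bform n (f : T -> 'M[R]_n) (M : 'M[R]_n) v :
  f @ F --> M -> bform (f t) v v @[t --> F] --> bform M v v.
Proof.
move=> hf; apply: cvg_mx_coord; apply: cvg_mulmx; last exact: cvg_cst.
by apply: cvg_mulmx => //; exact: cvg_cst.
Qed.

Lemma cvg_abs_sum n (f : T -> 'M[R]_n) (M : 'M[R]_n) :
  f @ F --> M -> abs_sum (f t - M) @[t --> F] --> 0.
Proof.
move=> hf; rewrite (_ : 0 = abs_sum (M - M)).
  apply: cvg_sum_fin => i; apply: cvg_sum_fin => j; apply: cvg_norm.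
  by apply: cvg_mx_coord; apply: cvgB => //; exact: cvg_cst.
rewrite subrr /abs_sum big1// => i _; rewrite big1// => j _.
by rewrite mxE normr0.
Qed.

(** If a I <= M, half of the margin a is kept as a lower bound for [f t] and the other half absorbs
    the perturbation [f t - M]. *)
Lemma near_pdmx n (f : T -> 'M[R]_n) (M : 'M[R]_n) : pdmx M -> f @ F --> M ->
  (forall t, (f t)^T = f t) -> \forall t \near F, pdmx (f t).
Proof.
move=> /pdmx_lower[a a0 hM] hf sf.
have h2 : loewner_le (a / 2)%:M (M - (a / 2)%:M).
  by rewrite /loewner_le -addrA -opprD -raddfD/= -splitr.
near=> t; apply: (@pdmx_le _ _ (a / 2)%:M).
  by apply: pdmx_scalar; rewrite divr_gt0.
apply: psdmx_near h2 _ _; first by rewrite linearB/= sf tr_scalar_mx.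
rewrite opprB addrA addrNK ltW//; near: t.
by apply: (cvgr_lt _ (cvg_abs_sum hf)); rewrite divr_gt0.
Unshelve. all: by end_near. Qed.

End MatrixLimits.

Lemma cvg_psdmx (R : realType) (T : Type) (F : set_system T) {FF : ProperFilter F} n
    (f : T -> 'M[R]_n) (M : 'M[R]_n) :
  f @ F --> M -> (\forall t \near F, psdmx (f t)) -> psdmx M.
Proof.
move=> hf hp; split.
  apply/matrixP => i j; rewrite mxE.
  have h1 : f t i j @[t --> F] --> M j i.
    apply: cvg_trans (cvg_mx_coord (i := j) (j := i) hf).
    apply: near_eq_cvg; apply: filterS hp => t [s _].
    by rewrite -[in LHS]s mxE.
  by have := cvg_unique _ h1 (cvg_mx_coord (i := i) (j := j) hf); exact.
move=> v; have := @cvgr_to_ge _ _ _ _ _ _ 0 (cvg_bform (v := v) hf).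
apply; by apply: filterS hp => t [_]; exact.
Qed.

(** * Spectral radius and growth of matrix powers *)

Section SpectralRadius.
Variable R : realType.
Local Notation normc := (ComplexField.Normc.normc).
Local Notation complexmx := (map_mx (real_complex R)).
Local Notation Re := (@complex.Re R).
Local Notation Im := (@complex.Im R).

Lemma normcR (x : R) : normc (real_complex R x) = `|x|.
Proof. by rewrite /= expr0n/= addr0 sqrtr_sqr. Qed.

Lemma normc_ge0 (z : R[i]) : 0 <= normc z.
Proof. by case: z => a b; exact: sqrtr_ge0. Qed.

(** The eigenvalues are the finitely many roots of the characteristic polynomial, so the sum of
    their moduli is a bound. This makes the [sup] in the spectral radius a genuine supremum when the
    spectrum is nonempty. *)
Lemma has_ubound_spectrum n (A : 'M[R]_n) :
  has_ubound [set normc z | z in [set z : R[i] | eigenvalue (complexmx A) z]].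
Proof.
have [rs hrs] := closed_field_poly_normal (char_poly (complexmx A)).
exists (\sum_(z <- rs) normc z) => _ [z /= + <-].
rewrite eigenvalue_root_char hrs rootZ ?lead_coef_eq0 ?monic_neq0 ?char_poly_monic//.
rewrite root_prod_XsubC => zrs.
by rewrite (big_rem z)//= lerDl sumr_ge0// => y _; exact: normc_ge0.
Qed.

Lemma normc_le_spectral_radius n (A : 'M[R]_n) z :
  eigenvalue (complexmx A) z -> normc z <= spectral_radius A.
Proof.
by move=> hz; apply: ub_le_sup; [exact: has_ubound_spectrum|exists z].
Qed.

(* Peeling off the linear factors one at a time: if the sequence
   [a k.+1 - r * a k] is O(s^k) with |r| < s, then so is [a]. *)
Lemma horner_mx_decay n (M : 'M[R[i]]_n.+1) (s : R) (rs : seq R[i]) :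
  (forall r, r \in rs -> normc r < s) ->
  forall Q : 'M[R[i]]_n.+1,
    Q * horner_mx M (\prod_(r <- rs) ('X - r%:P)) = 0 ->
    exists2 C : R, 0 <= C & forall k i j, normc ((Q * M ^+ k) i j) <= C * s ^+ k.
Proof.
elim: rs => [|r rs IH] hrs Q.
  rewrite big_nil rmorph1 mulr1 => ->; exists 0 => // k i j.
  by rewrite mul0r mxE mul0r/= expr0n/= addr0 sqrtr0.
rewrite big_cons rmorphM mulrA => hQ.
have [|C C0 hC] := IH _ _ hQ.
  by move=> x xrs; apply: hrs; rewrite inE xrs orbT.
have rs_s : normc r < s by apply: hrs; rewrite inE eqxx.
have s0 : 0 < s by apply: le_lt_trans rs_s; exact: normc_ge0.
(* The second summand gives [normc r * C1 + C <= C1 * s], which drives the induction; the first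
   covers k = 0. *)
pose C1 := \sum_i \sum_j normc (Q i j) + C / (s - normc r).
have C1ge : C / (s - normc r) <= C1.
  by rewrite lerDr; do 2!(apply: sumr_ge0 => ? _); exact: normc_ge0.
exists C1.
  by apply: le_trans C1ge; rewrite divr_ge0// subr_ge0 ltW.
elim=> [|k IHk] i j.
  rewrite !expr0 !mulr1 /C1 (bigD1 i)//= (bigD1 j)//= -!addrA lerDl.
  rewrite !addr_ge0 ?sumr_ge0 ?divr_ge0 ?subr_ge0 ?(ltW rs_s)//.
    by move=> ? _; exact: normc_ge0.
  by move=> ? _; rewrite sumr_ge0// => ? _; exact: normc_ge0.
have e : Q * M ^+ k.+1 =
    r *: (Q * M ^+ k) + Q * horner_mx M ('X - r%:P) * M ^+ k.
  rewrite rmorphB/= horner_mx_X horner_mx_C mulrBr mulrBl exprS mulrA.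
  have -> : Q * r%:M * M ^+ k = r *: (Q * M ^+ k).
    by rewrite -!mulmxE -scalemx1 -scalemxAr mulmx1 -scalemxAl.
  by rewrite addrC addrNK.
have e2 : (r *: (Q * M ^+ k)) i j = r * (Q * M ^+ k) i j by rewrite mxE.
rewrite e mxE.

rewrite e2; apply: le_trans (le_normcD _ _) _.
rewrite ComplexField.Normc.normcM.
apply: (@le_trans _ _ (normc r * (C1 * s ^+ k) + C * s ^+ k)).
  by apply: lerD; [apply: ler_wpM2l; [exact: normc_ge0|exact: IHk]|exact: hC].
rewrite exprS !mulrA -mulrDl ler_wpM2r ?(exprn_ge0 _ (ltW s0))//.
have := C1ge; rewrite ler_pdivrMr ?subr_gt0//; lra.
Qed.

(** All eigenvalues have modulus below some s < 1/rho, and Cayley-Hamilton allows the decay estimate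
    with Q = 1, so the entries of the powers of rho A are O((rho s)^k). *)
Lemma cvg_expmx n (A : 'M[R]_n) (rho : R) : 0 < rho ->
  (rho%:E < inv_spectral_radius A)%E ->
  (rho *: A) ^+ k @[k --> \oo] --> (0 : 'M[R]_n).
Proof.
case: n A => [|n] A r0 hr; first by apply: cvg_mx => -[].
set sg := spectral_radius A.
have rsg : sg < rho^-1.
  move: hr; rewrite /inv_spectral_radius inver -/sg.
  case: eqP => [-> _|_]; first by rewrite invr_gt0.
  rewrite lte_fin => h; have s0 : 0 < sg by rewrite -invr_gt0 (lt_trans r0).
  by rewrite -[sg]invrK ltf_pV2 ?posrE ?invr_gt0.
(* A midpoint of the gap below 1/rho; the maximum with 0 ensures that s is positive. *)
pose s := (Num.max sg 0 + rho^-1) / 2.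
have m1 : Num.max sg 0 < rho^-1 by rewrite gt_max rsg invr_gt0.
have s1 : Num.max sg 0 < s by rewrite /s; lra.
have s2 : s < rho^-1 by rewrite /s; lra.
have s0 : 0 < s by apply: le_lt_trans s1; rewrite le_max lexx orbT.
have [rs hrs] := closed_field_poly_normal (char_poly (complexmx A)).
rewrite (monicP (char_poly_monic _)) scale1r in hrs.
have hroots z : z \in rs -> normc z < s.
  move=> zrs; apply: le_lt_trans s1; rewrite le_max.
  by rewrite normc_le_spectral_radius// eigenvalue_root_char hrs root_prod_XsubC.
have [|C C0 hC] := @horner_mx_decay n (complexmx A) s rs hroots 1.
  by rewrite -hrs Cayley_Hamilton mulr0.
have hb k i j : `|((rho *: A) ^+ k) i j| <= C * (rho * s) ^+ k.
  have -> : (rho *: A) ^+ k = rho ^+ k *: A ^+ k by rewrite exprZn.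
  rewrite mxE normrM ger0_norm ?(exprn_ge0 _ (ltW r0))// exprMn mulrCA.
  rewrite ler_wpM2l ?(exprn_ge0 _ (ltW r0))//.
  by have := hC k i j; rewrite mul1r -rmorphXn/= mxE normcR.
apply: cvg_mx => i j; rewrite mxE.
have h : (fun k => C * (rho * s) ^+ k) @ \oo --> 0.
  rewrite -(mulr0 C); apply: cvgM; first exact: cvg_cst.
  apply: cvg_expr; rewrite gtr0_norm ?(mulr_gt0 r0 s0)//.
  by rewrite mulrC -ltr_pdivlMr// div1r.
apply: (squeeze_cvgr (f := fun k => - (C * (rho * s) ^+ k)) _ _ h).
  by apply: nearW => k; rewrite -ler_norml hb.
by rewrite -oppr0; exact: cvgN.
Qed.

(* The real and imaginary parts of a complex left eigenvector turn the
   Loewner inequality into [r^2 |z|^2 q <= q] with q > 0. *)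
Lemma spectral_radius_lt n (A P : 'M[R]_n) (rho r : R) : 1 < rho < r -> pdmx P ->
  loewner_le (r ^+ 2 *: (A *m P *m A^T)) P -> (rho%:E < inv_spectral_radius A)%E.
Proof.
move=> /andP[rho1 rr] hP hle; have r0 : 0 < r by lra.
have ub z : eigenvalue (complexmx A) z -> normc z <= r^-1.
  move=> /eigenvalueP[v vA v0].
  pose x := map_mx (Re) v; pose y := map_mx (Im) v.
  have hx : x *m A = Re z *: x - Im z *: y.
    apply/matrixP => i j; have := congr1 (fun M : 'rV_n => M i j) vA.
    rewrite !mxE => /(congr1 (Re)).
    rewrite raddf_sum/= => h.
    transitivity (Re (z * v i j)); last by case: z (v i j) {h vA} => a b [c d].
    rewrite -h; apply: eq_bigr => k _; rewrite !mxE; case: (v i k) => a b /=; ring.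
  have hy : y *m A = Im z *: x + Re z *: y.
    apply/matrixP => i j; have := congr1 (fun M : 'rV_n => M i j) vA.
    rewrite !mxE => /(congr1 (Im)).
    rewrite raddf_sum/= => h.
    transitivity (Im (z * v i j)); last first.
      by case: z (v i j) {h vA hx} => a b [c d] /=; rewrite addrC [b * c]mulrC; ring.
    rewrite -h; apply: eq_bigr => k _; rewrite !mxE; case: (v i k) => a b /=; ring.
  have sP := hP.1.
  pose q := bform P x^T x^T + bform P y^T y^T.
  have q0 : 0 < q.
    have qx := psd_bform x^T (pdmx_psd hP); have qy := psd_bform y^T (pdmx_psd hP).
    have [x0|x0] := eqVneq x 0; last first.
      by apply: ltr_pwDl => //; apply: pd_bform => //; rewrite trmx_eq0.
    apply: ltr_wpDl => //; apply: pd_bform => //; rewrite trmx_eq0.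
    apply: contra_neq v0 => y0; apply/matrixP => i j; rewrite mxE.
    have := congr1 (fun M : 'rV_n => M i j) x0.
    have := congr1 (fun M : 'rV_n => M i j) y0.
    by rewrite !mxE; case: (v i j) => a b /= -> ->.
  have hq u : r ^+ 2 * bform P (u *m A)^T (u *m A)^T <= bform P u^T u^T.
    have := loewner_le_bform u^T hle.
    by rewrite bformZm trmx_mul bform_mulr bform_mull trmxK mulmxA.
  have h := lerD (hq x) (hq y); rewrite -mulrDr -/q in h.
  have e : bform P (x *m A)^T (x *m A)^T + bform P (y *m A)^T (y *m A)^T
      = (Re z ^+ 2 + Im z ^+ 2) * q.
    rewrite hx hy !linearD/= !linearN/= !linearZ/= !bformL /q.
    rewrite (bformC y^T x^T sP); ring.
  rewrite e mulrA in h.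
  have h2 : r ^+ 2 * (Re z ^+ 2 + Im z ^+ 2) <= 1.
    by rewrite -(ler_pM2r q0) mul1r.
  have -> : normc z = Num.sqrt (Re z ^+ 2 + Im z ^+ 2) by case: z {vA hx hy h e h2}.
  rewrite -[r^-1]gtr0_norm ?invr_gt0// -sqrtr_sqr ler_sqrt ?exprn_even_ge0//.
  by rewrite exprVn -[leRHS]mul1r ler_pdivlMr ?exprn_gt0// mulrC.
have sg : spectral_radius A <= r^-1.
  rewrite /spectral_radius; set S := (X in sup X).
  (* For an empty spectrum [sup] takes its default value 0. *)
  have [->|/set0P S0] := eqVneq S set0; first by rewrite sup0 invr_ge0 ltW.
  by apply: ge_sup => // _ [z /= hz <-]; exact: ub.
rewrite /inv_spectral_radius inver; case: eqP => [_|/eqP n0]; first by rewrite ltry.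
have sg0 : 0 <= spectral_radius A.
  rewrite /spectral_radius; set S := (X in sup X).
  have [->|/set0P S0] := eqVneq S set0; first by rewrite sup0.
  have [_ [z /= hz _]] := S0.
  by apply: le_trans (normc_le_spectral_radius hz); exact: normc_ge0.
have sp : 0 < spectral_radius A by rewrite lt_neqAle eq_sym n0.
rewrite lte_fin (lt_le_trans rr)// -[r]invrK lef_pV2 ?posrE ?invr_gt0//.
Qed.

End SpectralRadius.

(** * Discrete Lyapunov equations for a matrix whose powers tend to 0 *)

Section Lyapunov.
Variables (R : realType) (n : nat) (M : 'M[R]_n).
Hypothesis M0 : M ^+ k @[k --> \oo] --> (0 : 'M[R]_n).

Lemma cvg_expmx_congr (S : 'M[R]_n) :
  (M ^+ k)^T *m S *m M ^+ k @[k --> \oo] --> (0 : 'M[R]_n).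
Proof.
rewrite -[0](mulmx0 _ ((0 : 'M[R]_n)^T *m S)); apply: cvg_mulmx => //.
by apply: cvg_mulmx; [exact: cvg_trmx|exact: cvg_cst].
Qed.

(** Iterating S >= M^T S M gives S >= (M^k)^T S M^k, whose right side tends to 0. *)
Lemma lyapunov_psdmx (S : 'M[R]_n) :
  S^T = S -> psdmx (S - M^T *m S *m M) -> psdmx S.
Proof.
move=> sS h.
have hk k : loewner_le ((M ^+ k)^T *m S *m M ^+ k) S.
  elim: k => [|k]; first by rewrite expr0 trmx1 mul1mx mulmx1; exact: loewner_le_refl.
  apply: loewner_le_trans; have := loewner_le_congr (M ^+ k) h.
  by rewrite exprS -mulmxE trmx_mul !mulmxA.
have hc : S - (M ^+ k)^T *m S *m M ^+ k @[k --> \oo] --> S.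
  rewrite -[X in _ --> X]subr0; apply: cvgB; first exact: cvg_cst.
  exact: cvg_expmx_congr.
by apply: cvg_psdmx hc _; exact: nearW.
Qed.

(** The difference of two solutions is fixed by the congruence with every M^k, hence equals the
    limit 0. *)
Lemma lyapunov_uniq (S1 S2 Q : 'M[R]_n) :
  S1 = M^T *m S1 *m M + Q -> S2 = M^T *m S2 *m M + Q -> S1 = S2.
Proof.
move=> h1 h2; apply/eqP; rewrite -subr_eq0; apply/eqP; set S := S1 - S2.
have hS : S = M^T *m S *m M.
  by rewrite /S {1}h1 {1}h2 opprD addrACA subrr addr0 mulmxBr mulmxBl.
have hk k : (M ^+ k)^T *m S *m M ^+ k = S.
  elim: k => [|k IH]; first by rewrite expr0 trmx1 mul1mx mulmx1.
  rewrite exprSr -mulmxE trmx_mul !mulmxA -[X in X *m M]mulmxA.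
  by rewrite -[X in X *m M]mulmxA [(M ^+ k)^T *m _]mulmxA IH -hS.
have hc := @cvg_expmx_congr S.
have hc2 : (M ^+ k)^T *m S *m M ^+ k @[k --> \oo] --> S.
  by under eq_fun do rewrite hk; exact: cvg_cst.
exact: (cvg_unique _ hc2 hc).
Qed.

(** The map sending S to S - M^T S M is linear on a finite-dimensional space and injective by
    uniqueness, hence surjective. *)
Lemma lyapunov_ex (Q : 'M[R]_n) : exists S, S = M^T *m S *m M + Q.
Proof.
pose L : {linear 'M[R]_n -> 'M[R]_n} := (idfun \- (mulmxr M \o mulmx M^T)).
have uL : lin_mx L \in unitmx.
  rewrite -row_free_unit -kermx_eq0; apply/rowV0P => v /sub_kermxP vL.
  have h : L (vec_mx v) = 0 by rewrite -mx_rV_lin vL linear0.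
  apply: (can_inj vec_mxK); rewrite linear0.
  apply: (@lyapunov_uniq _ _ 0); rewrite addr0; last by rewrite mulmx0 mul0mx.
  by apply/eqP; rewrite -subr_eq0; apply/eqP.
exists (vec_mx (mxvec Q *m invmx (lin_mx L))); set S := vec_mx _.
have h : L S = Q by rewrite -mx_rV_lin mulmxKV// mxvecK.
by rewrite -h /L/= addrC subrK.
Qed.

End Lyapunov.

(** * Bounds on [Sigma] from its Lyapunov equation *)

Section SigmaBounds.
Variables (R : realType) (n : nat) (A : 'M[R]_n) (theta rho : R).
Hypothesis (theta_ge0 : 0 <= theta) (rho_gt1 : 1 < rho).
Hypothesis rho_lt : (rho%:E < inv_spectral_radius A)%E.

(** Absorbing [rho] into the matrix turns the equation of [Sigma] into S = M^T S M + theta I, with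
    powers of M tending to 0. *)
Let M := rho *: A.
Let M0 : M ^+ k @[k --> \oo] --> (0 : 'M[R]_n).
Proof. by apply: cvg_expmx => //; exact: lt_trans rho_gt1. Qed.

Let MM (S : 'M[R]_n) : M^T *m S *m M = rho ^+ 2 *: (A^T *m S *m A).
Proof. by rewrite /M -scalemxAr [X in X *m S]linearZ/= -!scalemxAl scalerA expr2. Qed.

(** A solution exists, so [xget] returns one instead of its default 0. *)
Lemma SigmaE :
  Sigma A theta rho = rho ^+ 2 *: (A^T *m Sigma A theta rho *m A) + theta%:M.
Proof.
have [S hS] := lyapunov_ex M0 theta%:M; rewrite MM in hS.
have := @xgetPex _ 0 [set S | S = rho ^+ 2 *: (A^T *m S *m A) + theta%:M].
by apply; exists S.
Qed.

(** The transpose solves the same equation, and solutions are unique. *)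
Lemma trmx_Sigma : (Sigma A theta rho)^T = Sigma A theta rho.
Proof.
apply: (lyapunov_uniq M0 (Q := theta%:M)); rewrite MM; last exact: SigmaE.
by rewrite {1}SigmaE linearD/= linearZ/= !trmx_mul trmxK mulmxA tr_scalar_mx.
Qed.

Lemma Sigma_ge : loewner_le theta%:M (Sigma A theta rho).
Proof.
have e : Sigma A theta rho - theta%:M = M^T *m Sigma A theta rho *m M.
  by rewrite {1}SigmaE addrK MM.
rewrite /loewner_le e; apply: psdmx_congr.
apply: (lyapunov_psdmx M0 trmx_Sigma); rewrite MM {1}SigmaE addrC addKr.
exact: psdmx_scalar.
Qed.

(** Comparison principle: subtracting the equation of [Sigma] from the inequality for W leaves a
    Lyapunov inequality for the difference. *)
Lemma Sigma_le (W : 'M[R]_n) :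
  loewner_le (rho ^+ 2 *: (A^T *m W *m A) + theta%:M) W -> W^T = W ->
  loewner_le (Sigma A theta rho) W.
Proof.
move=> h sW; apply: (lyapunov_psdmx M0).
  by rewrite linearB/= sW trmx_Sigma.
move: h; rewrite /loewner_le; congr psdmx.
rewrite mulmxBr mulmxBl !MM {1}SigmaE.
move: (rho ^+ 2 *: (A^T *m W *m A)) (rho ^+ 2 *: (A^T *m Sigma A theta rho *m A)) => U V.
by apply/matrixP => i j; rewrite !mxE; ring.
Qed.

End SigmaBounds.

(** The quadratic forms are bounded monotone real sequences, hence converge, and polarization
    recovers each entry from the forms at e_i, e_j and e_i + e_j. *)
Lemma nondecreasing_mx_cvg (R : realType) n (X : nat -> 'M[R]_n) (S : 'M[R]_n) :
  (forall k, (X k)^T = X k) -> (forall k, loewner_le (X k) (X k.+1)) ->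
  (forall k, loewner_le (X k) S) -> exists L : 'M[R]_n, X @ \oo --> L.
Proof.
move=> sX monoX ubX.
have hq v : cvgn (fun k => bform (X k) v v).
  apply: nondecreasing_is_cvgn.
    by apply/nondecreasing_seqP => k; exact: loewner_le_bform.
  by exists (bform S v v) => _ [k _ <-]; exact: loewner_le_bform.
have hc i j : cvgn (fun k => X k i j).
  pose e k : 'cV[R]_n := delta_mx k 0.
  have -> : (fun k => X k i j) = (fun k => 2^-1 * (bform (X k) (e i + e j) (e i + e j)
      - bform (X k) (e i) (e i) - bform (X k) (e j) (e j))).
    apply/funext => k; rewrite !bformL (bformC (e j) (e i) (sX k)) !bform_delta.
    by field.
  by apply: is_cvgM; [exact: is_cvg_cst|do !apply: is_cvgB].
exists (\matrix_(i, j) lim (X k i j @[k --> \oo])).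
by apply: cvg_mx => i j; rewrite mxE; exact: hc.
Qed.

(** * The monotone backward iteration and its limit *)

Section BackwardConvergence.
Variables (R : realType) (n m : nat).
Variables (A : 'M[R]_n) (B : 'M[R]_(n, m)) (theta rho : R).
Hypothesis (theta_gt0 : 0 < theta) (BB_gt0 : pdmx (B *m B^T)).
Hypothesis rho_adm : admissible_rho A B theta rho.

Let N := B *m B^T.
Let Sg := Sigma A theta rho.

Let rho_gt1 : 1 < rho. Proof. by case: rho_adm. Qed.
Let rho_lt : (rho%:E < inv_spectral_radius A)%E. Proof. by case: rho_adm. Qed.
Let hSg : loewner_le N ((1 - rho ^- 2) *: invmx Sg).
Proof. by case: rho_adm => _ _; rewrite /loewner_le subr0. Qed.

Let Sg_ge : loewner_le theta%:M Sg.
Proof. exact: Sigma_ge (ltW theta_gt0) rho_gt1 rho_lt. Qed.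

Let Sg_gt0 : pdmx Sg.
Proof. exact: pdmx_le (pdmx_scalar _ theta_gt0) Sg_ge. Qed.

Let rho2 : 0 < rho ^- 2 < 1.
Proof.
have h : 1 < rho ^+ 2 by rewrite exprn_egt1.
by rewrite invr_gt0 (lt_trans ltr01 h)/= invf_lt1// (lt_trans ltr01 h).
Qed.

Lemma order_interval_pdmx X : order_interval A theta rho X -> pdmx X.
Proof. by case=> _ h _; exact: pdmx_le (pdmx_scalar _ theta_gt0) h. Qed.

Lemma loewner_le_resolvent X : order_interval A theta rho X ->
  loewner_le (rho ^- 2 *: invmx Sg) (invmx X - N).
Proof.
move=> hX; have X0 := order_interval_pdmx hX; case: hX => _ _ hX.
apply: (@loewner_le_trans _ _ (invmx Sg - N)).
  move: hSg; rewrite /loewner_le scalerBl scale1r; congr psdmx.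
  by rewrite addrAC.
exact: loewner_le_add2r (loewner_le_inv X0 hX).
Qed.

Lemma resolvent_pdmx X : order_interval A theta rho X -> pdmx (invmx X - N).
Proof.
move=> /loewner_le_resolvent; apply: pdmx_le; apply: pdmxZ.
  by case/andP: rho2.
exact: pdmx_inv.
Qed.

(** Inverting the admissibility inequality gives Sigma <= (1 - rho^-2) N^-1, so X stays below N^-1
    with a gap of at least rho^-2 N^-1. *)
Lemma order_interval_Theta_domain X :
  order_interval A theta rho X -> Theta_domain B X.
Proof.
move=> hX; split; first exact: order_interval_pdmx.
case: hX => _ _ hX; have /andP[r0 r1] := rho2.
have h : loewner_le Sg ((1 - rho ^- 2) *: invmx N).
  have := loewner_leZ (_ : 0 <= 1 - rho ^- 2) (loewner_le_inv BB_gt0 hSg).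
  rewrite subr_ge0 => /(_ (ltW r1)); rewrite invmxZ ?invmxK.
    by rewrite scalerA divff ?scale1r// subr_eq0 eq_sym lt_eqF.
  apply: pdmx_unit; apply: pdmxZ; [by rewrite subr_gt0|exact: pdmx_inv].
rewrite /loewner_lt -/N; apply: (@pdmx_le _ _ (rho ^- 2 *: invmx N)).
  by apply: pdmxZ => //; exact: pdmx_inv.
have := loewner_le_trans hX h; rewrite /loewner_le scalerBl scale1r.
by congr psdmx; rewrite addrAC.
Qed.

(** Inversion occurs twice, so its two order reversals cancel. *)
Lemma Theta_mono X Y : order_interval A theta rho X ->
  order_interval A theta rho Y -> loewner_le X Y ->
  loewner_le (Theta A B theta X) (Theta A B theta Y).
Proof.
move=> hX hY hXY; apply: loewner_le_add2r; apply: loewner_le_congr.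
apply: loewner_le_inv; first exact: resolvent_pdmx.
by apply: loewner_le_add2r; apply: loewner_le_inv => //; exact: order_interval_pdmx.
Qed.

(** Inverting the lower bound rho^-2 Sigma^-1 of X^-1 - N gives rho^2 Sigma, and the equation of
    [Sigma] turns the resulting upper bound back into Sigma. *)
Lemma Theta_order_interval X : order_interval A theta rho X ->
  order_interval A theta rho (Theta A B theta X).
Proof.
move=> hX; have hR := resolvent_pdmx hX.
have ge : loewner_le theta%:M (Theta A B theta X).
  rewrite /loewner_le /Theta addrK; apply: psdmx_congr; apply: pdmx_psd.
  exact: pdmx_inv.
split => //; first by have [] := pdmx_le (pdmx_scalar _ theta_gt0) ge.
rewrite /Theta (SigmaE theta rho_gt1 rho_lt); apply: loewner_le_add2r.
have /andP[r0 r1] := rho2.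
have := loewner_le_inv (pdmxZ r0 (pdmx_inv Sg_gt0)) (loewner_le_resolvent hX).
move/(loewner_le_congr A); congr loewner_le.
rewrite invmxZ ?invmxK ?invrK; first by rewrite -scalemxAr -scalemxAl.
by apply: pdmx_unit; apply: pdmxZ => //; exact: pdmx_inv.
Qed.

Lemma admissible_backward_convergence : backward_convergence A B theta rho.
Proof.
move=> T X XT Xrec.
(* Time is reversed, so the recursion becomes a forward iteration of [Theta] from theta I. *)
pose Y k := X (T - k%:Z).
have Y0 : Y 0%N = theta%:M by rewrite /Y subr0.
have YS k : Y k.+1 = Theta A B theta (Y k).
  rewrite /Y Xrec; last by rewrite ltrBlDr ltrDl.
  by congr (Theta _ _ _ (X _)); rewrite -addn1 PoszD opprD addrA subrK.
have hY k : order_interval A theta rho (Y k).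
  elim: k => [|k IH]; last by rewrite YS; exact: Theta_order_interval.
  by rewrite Y0; split; [exact: tr_scalar_mx|exact: loewner_le_refl|exact: Sg_ge].
(* The first step increases because every iterate lies above theta I; monotonicity of [Theta]
   propagates this. *)
have monoY k : loewner_le (Y k) (Y k.+1).
  elim: k => [|k IH]; first by rewrite Y0; case: (hY 1%N).
  by rewrite !YS; apply: Theta_mono => //; rewrite -YS.
have toY t : t <= T -> exists k, t = T - k%:Z.
  move=> tT; exists `|(T - t)%R|%N; rewrite gez0_abs ?subr_ge0//.
  by rewrite opprB addrC subrK.
split.
- move=> t /toY[k ->]; have := hY k; split => //.
  exact: order_interval_Theta_domain.
- move=> t tT; have [|k tk] := toY (t + 1); first by rewrite lezD1.
  have e : t = T - k.+1%:Z by rewrite -addn1 PoszD opprD addrA -tk addrK.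
  by rewrite tk e; exact: monoY.
have [L hL] : exists L : 'M[R]_n, Y @ \oo --> L.
  by apply: (nondecreasing_mx_cvg (S := Sg)) => // k; case: (hY k).
have hLI : order_interval A theta rho L.
  have le1 : loewner_le theta%:M L.
    apply: (@cvg_psdmx _ _ \oo _ _ (fun k => Y k - theta%:M)).
      by apply: cvgB => //; exact: cvg_cst.
    by apply: nearW => k; case: (hY k).
  split => //; first by have [] := pdmx_le (pdmx_scalar _ theta_gt0) le1.
  apply: (@cvg_psdmx _ _ \oo _ _ (fun k => Sg - Y k)).
    by apply: cvgB => //; exact: cvg_cst.
  by apply: nearW => k; case: (hY k).
exists L; split => //; first exact: order_interval_Theta_domain.
(* As L lies in the order interval, both L and L^-1 - N are invertible, which gives continuity of
   [Theta] at L. *)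
have hT : Theta A B theta (Y k) @[k --> \oo] --> Theta A B theta L.
  apply: cvgD; last exact: cvg_cst.
  apply: cvg_mulmx; last exact: cvg_cst.
  apply: cvg_mulmx; first exact: cvg_cst.
  apply: cvg_invmx; first exact: pdmx_unit (resolvent_pdmx hLI).
  apply: cvgB; last exact: cvg_cst.
  by apply: cvg_invmx => //; exact: pdmx_unit (order_interval_pdmx hLI).
have hT2 : Theta A B theta (Y k) @[k --> \oo] --> L.
  under eq_fun do rewrite -YS.
  by have := hL; rewrite -cvg_shiftS.
exact: cvg_unique hT2 hT.
Qed.

End BackwardConvergence.

(** * Hadamard's inequality and the function x - ln (1 + x) *)

Section Hadamard.
Variable R : realType.

(* Block elimination of the first row and column; the Schur complement
   has smaller diagonal entries. *)
Lemma pdmx_hadamard n (M : 'M[R]_n) : pdmx M -> 0 < \det M <= \prod_i M i i.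
Proof.
elim: n M => [|n IH] M hM; first by rewrite det_mx00 big_ord0 ltr01 lexx.
rewrite -[n.+1]/(1 + n)%N in M hM *.
pose a : R := M 0 0; pose b : 'rV[R]_n := ursubmx M; pose S := drsubmx M.
have a0 : 0 < a.
  rewrite /a -bform_delta; apply: pd_bform => //.
  apply/eqP => /matrixP/(_ 0 0); rewrite !mxE eqxx => /eqP.
  by rewrite oner_eq0.
have MB : M = block_mx a%:M b b^T S.
  rewrite -[LHS]submxK; congr block_mx.
    by rewrite [ulsubmx M]mx11_scalar !mxE; congr (M _ _)%:M; apply/val_inj.
  by rewrite -{1}hM.1 -trmx_ursub.
(* The columns of K are M-orthogonal to the first coordinate vector, so K^T M K is the Schur
   complement Z, which thereby inherits definiteness. *)
pose K : 'M[R]_(1 + n, n) := col_mx (- a^-1 *: b) 1%:M.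
pose Z := S - a^-1 *: (b^T *m b).
have MK : M *m K = col_mx 0 Z.
  rewrite MB mul_block_col !mulmx1 mul_scalar_mx scalerA mulrN divff ?gt_eqF//.
  by rewrite scaleN1r addNr -scalemxAr scaleNr addrC.
have ZK : Z = K^T *m M *m K.
  by rewrite -mulmxA MK tr_col_mx mul_row_col mulmx0 add0r trmx1 mul1mx.
have hZ : pdmx Z.
  rewrite ZK; apply: pdmx_congr => // v.
  by rewrite mul_col_mx mul1mx -[0]col_mx0 => /eq_col_mx[].
have dM : \det M = a * \det Z.
  have -> : M = block_mx 1%:M 0 (a^-1 *: b^T) 1%:M *m block_mx a%:M b 0 Z.
    rewrite mulmx_block !mul1mx !mul0mx !addr0 {1}MB; congr block_mx.
      by rewrite mul_mx_scalar scalerA divff ?gt_eqF// scale1r.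
    by rewrite -scalemxAl /Z addrC subrK.
  by rewrite det_mulmx det_lblock det_ublock !det1 !mul1r det_scalar1.
have /andP[dZ0 dZ] := IH _ hZ.
rewrite dM mulr_gt0//= big_split_ord/= big_ord1.
have -> : M (lshift n 0) (lshift n 0) = a by congr (M _ _); apply/val_inj.
rewrite ler_wpM2l ?(ltW a0)//; apply: le_trans dZ _.
apply: ler_prod => i _.
have := pd_bform (v := delta_mx i 0) hZ; rewrite bform_delta => h.
have Zi : 0 < Z i i.
  apply: h; apply/eqP => /matrixP/(_ i 0); rewrite !mxE !eqxx => /eqP.
  by rewrite oner_eq0.
rewrite (ltW Zi)/=.
have -> : Z i i = M (rshift 1 i) (rshift 1 i) - a^-1 * (b 0 i) ^+ 2.
  by rewrite !mxE big_ord1 !mxE expr2.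
by rewrite gerBl mulr_ge0 ?invr_ge0 ?(ltW a0)// sqr_ge0.
Qed.

Lemma ln_prod (I : finType) (F : I -> R) : (forall i, 0 < F i) ->
  ln (\prod_i F i) = \sum_i ln (F i).
Proof.
(* Positivity of the partial products is carried through the induction, because [lnM] asks for
   positive factors. *)
move=> hF; apply: (@proj2 (0 < \prod_i F i)).
elim/big_ind2 : _ => [|x1 x2 y1 y2 [h1 h2] [h3 h4]|i _]; last by [].
  by rewrite ln1.
by rewrite mulr_gt0// lnM ?posrE// h2 h4.
Qed.

Lemma subr_ln1D_ge0 (x : R) : 0 <= x -> 0 <= x - ln (1 + x).
Proof. by move=> x0; rewrite subr_ge0 le_ln1Dx// (lt_le_trans _ x0)// ltrN10. Qed.

Lemma subr_ln1D_gt0 (x : R) : 0 < x -> 0 < x - ln (1 + x).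
Proof.
move=> x0; rewrite subr_gt0 -[ltRHS]expRK ltr_ln ?posrE ?expR_gt0 ?addr_gt0//.
by rewrite expR_gt1Dx// gt_eqF.
Qed.

(** The bound ln z <= z - 1 at z = (1 + y) / (1 + x) gives ln (1 + y) - ln (1 + x) <= (y - x) / (1 +
    x) <= y - x. *)
Lemma subr_ln1D_mono (x y : R) : 0 <= x -> x <= y ->
  x - ln (1 + x) <= y - ln (1 + y).
Proof.
move=> x0 xy; have x1 : 0 < 1 + x by lra.
have y1 : 0 < 1 + y by lra.
suff : ln (1 + y) - ln (1 + x) <= y - x by lra.
rewrite -ln_div ?posrE//.
have -> : (1 + y) / (1 + x) = 1 + (y - x) / (1 + x) by field; rewrite gt_eqF.
have d0 : 0 <= (y - x) / (1 + x) by rewrite divr_ge0//; lra.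
apply: le_trans (le_ln1Dx _) _; first by lra.
by rewrite ler_pdivrMr//; nra.
Qed.

End Hadamard.

(** * A lower bound on [gamma] *)

Section RiskParameter.
Variables (R : realType) (n : nat) (P : 'M[R]_n) (theta : R).
Hypotheses (P0 : pdmx P) (theta0 : 0 <= theta).
Hypothesis hP : pdmx (invmx P - theta%:M).

(** From P^-1 >= (theta + a) I with a > 0 comes theta P <= theta / (theta + a) I, hence I - theta P
    >= a / (theta + a) I. *)
Lemma risk_pdmx : pdmx (1%:M - theta *: P).
Proof.
have [a a0 ha] := pdmx_lower hP.
have t0 : 0 < theta + a by rewrite ltr_wpDl.
have h1 : loewner_le (theta + a)%:M (invmx P).
  by move: ha; rewrite /loewner_le raddfD/= opprD addrA.
have := loewner_le_inv (pdmx_scalar n t0) h1.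
rewrite invmxK invmx_scalar_mx ?gt_eqF// => /(loewner_leZ theta0) h2.
apply: (@pdmx_le _ _ (a / (theta + a))%:M).
  by apply: pdmx_scalar; rewrite divr_gt0.
move: h2; rewrite /loewner_le scale_scalar_mx.
have -> : (a / (theta + a)) = 1 - theta / (theta + a) by field; rewrite gt_eqF.
by rewrite raddfB/= opprB [_ + (_ - 1%:M)]addrC addrA subrK.
Qed.

(** By Hadamard, 2 gamma is at least the sum of the M_ii - 1 - ln M_ii for M = (I - theta P)^-1; all
    terms are nonnegative and only the k-th is kept. *)
Lemma gamma_ge k :
  theta * P k k - ln (1 + theta * P k k) <= 2 * gamma P theta.
Proof.
have h := risk_pdmx; have hI := pdmx_inv h.
set M := invmx (1%:M - theta *: P).
(* The variational bound at e_i with test vector e_i reads 2 - (1 - theta P_ii) <= M_ii. *)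
have Mge i : 1 + theta * P i i <= M i i.
  rewrite -[M i i]bform_delta; set e := delta_mx i 0.
  apply: le_trans (bform_inv_ge e e h); rewrite bformBm bformZm !bform_delta.
  by rewrite mxE eqxx/= mulr1n; lra.
have Pi i : 0 <= P i i by rewrite -bform_delta; exact: psd_bform (pdmx_psd P0).
have Mge1 i : 1 <= M i i by apply: le_trans (Mge i); rewrite lerDl mulr_ge0.
have /andP[d0 dM] := pdmx_hadamard hI.
have Mpos i : 0 < M i i by apply: lt_le_trans (Mge1 i).
have hdet : \det (1%:M - theta *: P) = (\det M)^-1.
  by rewrite -[in LHS](invmxK (1%:M - _)) det_inv.
have hln : ln (\det M) <= \sum_i ln (M i i).
  rewrite -ln_prod// ler_ln ?posrE//; exact: lt_le_trans d0 dM.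
rewrite /gamma -/M hdet lnV ?posrE// [2 * _]mulrC divfK ?pnatr_eq0//.
have hn : n%:R = \sum_(i < n) 1 :> R by rewrite sumr_const card_ord.
have : \sum_i ((M i i - 1) - ln (1 + (M i i - 1))) <=
    - ln (\det M) + \tr M - n%:R.
  under eq_bigr do rewrite [1 + _]addrC subrK.
  rewrite !sumrB.
  by rewrite hn -/(mxtrace M); lra.
apply: le_trans; rewrite (bigD1 k)//=.
apply: (@le_trans _ _ ((M k k - 1) - ln (1 + (M k k - 1)))).
  apply: subr_ln1D_mono; first by rewrite mulr_ge0.
  by have := Mge k; lra.
rewrite lerDl sumr_ge0// => i _; apply: subr_ln1D_ge0.
by rewrite subr_ge0.
Qed.

End RiskParameter.

(** * Strict contractions and admissibility of [rho] *)

Section Contraction.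
Variables (R : realType) (n : nat).

(** Some mu > 0 satisfies mu P <= N, so M P M^T <= (1 - mu) P, and r = 1 + mu/2 satisfies r^2 (1 -
    mu) <= 1. *)
Lemma stein_contraction (M P N : 'M[R]_n) : pdmx P -> pdmx N ->
  P = M *m P *m M^T + N ->
  exists2 r : R, 1 < r & loewner_le (r ^+ 2 *: (M *m P *m M^T)) P.
Proof.
move=> hP hN e; have [a a0 ha] := pdmx_lower hN.
have K0 := abs_sum_ge0 P.
(* The denominator keeps [mu * abs_sum P] below a and mu at most 1/2. *)
pose mu := a / (abs_sum P + 2 * a).
have d0 : 0 < abs_sum P + 2 * a by lra.
have mu0 : 0 < mu by rewrite divr_gt0.
have mu1 : mu <= 1 / 2 by rewrite ler_pdivrMr//; lra.
have muP : loewner_le (mu *: P) N.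
  apply: loewner_le_trans ha.
  apply: loewner_le_trans (loewner_leZ (ltW mu0) (loewner_le_abs_sum hP.1)) _.
  rewrite scale_scalar_mx /loewner_le -raddfB/=; apply: psdmx_scalar.
  by rewrite subr_ge0 mulrAC ler_pdivrMr// ler_wpM2l ?(ltW a0)//; lra.
exists (1 + mu / 2); first by lra.
have -> : M *m P *m M^T = P - N by rewrite {2}e addrK.
apply: (@loewner_le_trans _ _ ((1 + mu / 2) ^+ 2 *: ((1 - mu) *: P))).
  apply: loewner_leZ; first exact: sqr_ge0.
  rewrite /loewner_le scalerBl scale1r opprB addrC addrA subrK.
  exact: muP.
rewrite scalerA /loewner_le -{1}[P]scale1r -scalerBl.
apply: psdmxZ (pdmx_psd hP); rewrite subr_ge0; nra.
Qed.

(** A multiple k W with k proportional to theta satisfies the Lyapunov inequality, so Sigma <= k W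
    and Sigma^-1 >= (v / k) I; for small theta this dominates b I. *)
Lemma admissible_of_contraction m (A W : 'M[R]_n) (B : 'M[R]_(n, m))
    (theta rho r w v b : R) :
  pdmx W -> 1 < rho < r -> loewner_le (r ^+ 2 *: (A^T *m W *m A)) W ->
  0 < w -> loewner_le w%:M W -> 0 < v -> loewner_le v%:M (invmx W) ->
  loewner_le (B *m B^T) b%:M -> 0 < theta ->
  theta * b <= (1 - rho ^- 2) * v * ((1 - rho ^+ 2 / r ^+ 2) * w) ->
  admissible_rho A B theta rho.
Proof.
move=> hW rr hc w0 hw v0 hv hb t0 hsmall.
have /andP[rho1 rhor] := rr.
have rho0 : 0 < rho by lra.
have r0 : 0 < r by lra.
have hsp : (rho%:E < inv_spectral_radius A)%E.
  (* Duality converts the contraction of W by A^T into one of W^-1 by A, the form asked for here. *)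
  apply: (spectral_radius_lt rr (pdmx_inv hW)).
  have := @loewner_le_dual _ _ W (r *: A^T) hW.
  rewrite (_ : (r *: A^T)^T = r *: A); last by rewrite linearZ/= trmxK.
  rewrite -!scalemxAr -!scalemxAl !scalerA -!expr2.
  exact.
pose d := 1 - rho ^+ 2 / r ^+ 2.
have d0 : 0 < d.
  rewrite subr_gt0 ltr_pdivrMr ?exprn_gt0// mul1r ltr_pXn2r ?nnegrE ?ltW//.
(* The solution of k = (rho^2 / r^2) k + theta / w: the first term pays for the contraction, the
   second for theta I. *)
pose k := theta / (d * w).
have k0 : 0 < k by rewrite divr_gt0// mulr_gt0.
have hS : loewner_le (Sigma A theta rho) (k *: W).
  apply: (Sigma_le rho1 hsp); last by rewrite linearZ/= hW.1.
  have e : k *: W = (rho ^+ 2 * k / r ^+ 2) *: W + (theta / w) *: W.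
    by rewrite -scalerDl; congr (_ *: _); rewrite /k /d; field;
       rewrite ?gt_eqF// subr_gt0 ltr_pXn2r ?nnegrE ?ltW.
  rewrite [X in loewner_le _ X]e; apply: loewner_leD.
    rewrite -!scalemxAr -!scalemxAl scalerA.
    have := loewner_leZ (_ : 0 <= rho ^+ 2 * k / r ^+ 2) hc.
    rewrite scalerA divfK ?expf_eq0 ?gt_eqF//; apply.
    by apply: divr_ge0; [apply: mulr_ge0; [exact: sqr_ge0|exact: ltW]|exact: sqr_ge0].
  have := loewner_leZ (_ : 0 <= theta / w) hw.
  rewrite scale_scalar_mx divfK ?gt_eqF//; apply.
  by rewrite divr_ge0 ?ltW.
split=> //; rewrite /loewner_le subr0.
have S0 := pdmx_le (pdmx_scalar n t0) (Sigma_ge (ltW t0) rho1 hsp).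
have rho2 : 0 < 1 - rho ^- 2.
  by rewrite subr_gt0 invf_lt1 ?exprn_gt0// exprn_egt1.
suff : loewner_le (B *m B^T) ((1 - rho ^- 2) *: invmx (Sigma A theta rho)) by [].
apply: loewner_le_trans hb _.
apply: (@loewner_le_trans _ _ ((1 - rho ^- 2) *: (k^-1 *: v%:M))).
  rewrite !scale_scalar_mx /loewner_le -raddfB/=; apply: psdmx_scalar.
  rewrite subr_ge0 /k invf_div -(ler_pM2l t0) (le_trans hsmall)//.
  rewrite -/d le_eqVlt; apply/orP; left; apply/eqP; field.
  by rewrite ?gt_eqF.
apply: loewner_leZ; first exact: ltW.
apply: (@loewner_le_trans _ _ (k^-1 *: invmx W)).
  by apply: loewner_leZ => //; rewrite invr_ge0 ltW.
by rewrite -invmxZ; [exact: loewner_le_inv|exact: pdmx_unit (pdmxZ k0 hW)].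
Qed.

(** Lowering the rate from r to s leaves the gap (1 - s^2 / r^2) W at the limit matrix, where W =
    P^-1, and definiteness survives small changes of A. *)
Lemma near_contraction T (F : set_system T) {FF : Filter F} (A : T -> 'M[R]_n)
    (A0 P : 'M[R]_n) (s r : R) :
  A @ F --> A0 -> pdmx P -> 0 < s < r ->
  loewner_le (r ^+ 2 *: (A0 *m P *m A0^T)) P ->
  \forall t \near F, loewner_le (s ^+ 2 *: ((A t)^T *m invmx P *m A t)) (invmx P).
Proof.
move=> hA hP /andP[s0 sr] hc; have r0 := lt_trans s0 sr.
set W := invmx P; have hW : pdmx W := pdmx_inv hP.
have h0 : loewner_le (r ^+ 2 *: (A0^T *m W *m A0)) W.
  have := @loewner_le_dual _ _ P (r *: A0) hP.
  rewrite (_ : (r *: A0)^T = r *: A0^T); last by rewrite linearZ.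
  rewrite -!scalemxAr -!scalemxAl !scalerA -!expr2.
  exact.
have pd0 : pdmx (W - s ^+ 2 *: (A0^T *m W *m A0)).
  apply: (@pdmx_le _ _ ((1 - s ^+ 2 / r ^+ 2) *: W)).
    apply: pdmxZ => //.
    by rewrite subr_gt0 ltr_pdivrMr ?exprn_gt0// mul1r ltr_pXn2r ?nnegrE ?ltW.
  have := loewner_leZ (_ : 0 <= s ^+ 2 / r ^+ 2) h0.
  rewrite divr_ge0 ?sqr_ge0// => /(_ isT); rewrite scalerA divfK ?expf_eq0 ?gt_eqF//.
  rewrite /loewner_le scalerBl scale1r opprB; congr psdmx.
  by rewrite [RHS]addrC addrA subrK.
have hcv : W - s ^+ 2 *: ((A t)^T *m W *m A t) @[t --> F] -->
    W - s ^+ 2 *: (A0^T *m W *m A0).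
  apply: cvgB; first exact: cvg_cst.
  apply: cvgZ; first exact: cvg_cst.
  by apply: cvg_mulmx => //; apply: cvg_mulmx; [exact: cvg_trmx|exact: cvg_cst].
have sym t : (W - s ^+ 2 *: ((A t)^T *m W *m A t))^T =
    W - s ^+ 2 *: ((A t)^T *m W *m A t).
  by rewrite linearB/= linearZ/= !trmx_mul trmxK hW.1 mulmxA.
by apply: filterS (near_pdmx pd0 hcv sym) => t; exact: pdmx_psd.
Qed.

End Contraction.

(** * Algebra and limits of the robust filter *)

Section Filter.
Variables (R : realType) (n p : nat).
Variables (A : 'M[R]_n) (B : 'M[R]_(n, n + p)).
Variables (C : 'M[R]_(p, n)) (D : 'M[R]_(p, n + p)).
Hypotheses (hBD : B *m D^T = 0) (hinv : col_mx B D \in unitmx).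

(** A left kernel vector of B, padded with zeros, is a left kernel vector of the invertible stacked
    matrix. *)
Lemma state_noise_pdmx : pdmx (B *m B^T).
Proof.
apply: pdmx_gram => v vB.
have : row_mx v 0 *m col_mx B D = 0 by rewrite mul_row_col vB mul0mx addr0.
move=> /(congr1 (mulmxr (invmx (col_mx B D)))) /=; rewrite mulmxK// mul0mx.
by rewrite -[0 in RHS]row_mx0 => /eq_row_mx[].
Qed.

Lemma output_noise_pdmx : pdmx (D *m D^T).
Proof.
apply: pdmx_gram => v vD.
have : row_mx 0 v *m col_mx B D = 0 by rewrite mul_row_col vD mul0mx addr0.
move=> /(congr1 (mulmxr (invmx (col_mx B D)))) /=; rewrite mulmxK// mul0mx.
by rewrite -[0 in RHS]row_mx0 => /eq_row_mx[].
Qed.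

Lemma innovation_pdmx V : psdmx V -> pdmx (C *m V *m C^T + D *m D^T).
Proof.
move=> hV; rewrite addrC; apply: pdmxD; first exact: output_noise_pdmx.
by have := psdmx_congr C^T hV; rewrite trmxK.
Qed.

Lemma information_pdmx X : pdmx X ->
  pdmx (X + C^T *m invmx (D *m D^T) *m C).
Proof.
move=> hX; apply: pdmxD => //; apply: psdmx_congr; apply: pdmx_psd.
exact: pdmx_inv output_noise_pdmx.
Qed.

Lemma riccati_ge theta P : riccati_solution A B C D theta P ->
  loewner_le (B *m B^T) P.
Proof.
case=> hP hV e; rewrite [X in loewner_le _ X]e /loewner_le addrK.
have := psdmx_congr A^T (pdmx_psd (pdmx_inv (information_pdmx hV))).
by rewrite trmxK.
Qed.

Lemma closed_loop_B_gram (G : 'M[R]_(n, p)) :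
  closed_loop_B B D G *m (closed_loop_B B D G)^T =
  B *m B^T + G *m (D *m D^T) *m G^T.
Proof.
have hDB : D *m B^T = 0 by rewrite -[LHS]trmxK trmx_mul trmxK hBD trmx0.
rewrite /closed_loop_B linearB/= trmx_mul mulmxBl !mulmxBr !mulmxA.
rewrite hBD mul0mx subr0 -[G *m D *m B^T]mulmxA hDB mulmx0 sub0r opprK.
by [].
Qed.

Lemma closed_loop_B_pdmx (G : 'M[R]_(n, p)) :
  pdmx (closed_loop_B B D G *m (closed_loop_B B D G)^T).
Proof.
rewrite closed_loop_B_gram; apply: pdmxD; first exact: state_noise_pdmx.
have := psdmx_congr G^T (pdmx_psd output_noise_pdmx).
by rewrite trmxK.
Qed.

(** The matrix inversion lemma of Woodbury, checked by multiplying out. *)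
Lemma invmx_information P : pdmx P ->
  invmx (invmx P + C^T *m invmx (D *m D^T) *m C) =
  P - P *m C^T *m invmx (C *m P *m C^T + D *m D^T) *m (C *m P).
Proof.
move=> hP; set Q := D *m D^T; set S := C *m P *m C^T + Q.
have uQ : Q \in unitmx := pdmx_unit output_noise_pdmx.
have uS : S \in unitmx := pdmx_unit (innovation_pdmx (pdmx_psd hP)).
have uP := pdmx_unit hP.
set Y := invmx P + _; set X := P - _.
have uY : Y \in unitmx by apply: pdmx_unit; apply: information_pdmx; exact: pdmx_inv.
suff YX : Y *m X = 1%:M by rewrite -[X](mulKmx uY) YX mulmx1.
rewrite /Y /X mulmxDl !mulmxBr mulVmx// -!mulmxA mulKmx//.
set U := C *m P.
have -> : invmx Q *m (C *m (P *m (C^T *m (invmx S *m U)))) =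
    invmx Q *m U - invmx S *m U.
  have -> : C *m (P *m (C^T *m (invmx S *m U))) = (S - Q) *m (invmx S *m U).
    by rewrite /S addrK !mulmxA.
  by rewrite mulmxBl mulKVmx// mulmxBr mulKmx.
by rewrite mulmxBr opprB [_ + (_ - _)]addrC !subrK.
Qed.

(** Joseph form of the Kalman Riccati equation: the gain identity G S = A P C^T turns the terms
    quadratic in G into A P C^T G^T, which cancels one cross term, and the other is the correction
    in the Riccati equation. *)
Lemma riccati0_stein P : riccati_solution A B C D 0 P ->
  let G := gain_of_riccati A C D 0 P in
  P = closed_loop_A A C G *m P *m (closed_loop_A A C G)^T +
      closed_loop_B B D G *m (closed_loop_B B D G)^T.
Proof.
case=> hP _; rewrite raddf0 subr0 invmx_information// => e G.
rewrite closed_loop_B_gram; set Q := D *m D^T.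
have sP := hP.1; have sQ : Q^T = Q by rewrite trmx_mul trmxK.
set S := C *m P *m C^T + Q.
have uS : S \in unitmx := pdmx_unit (innovation_pdmx (pdmx_psd hP)).
have GE : G = A *m P *m C^T *m invmx S.
  by rewrite /G /gain_of_riccati raddf0 subr0 invmxK.
have GS : G *m S = A *m P *m C^T by rewrite GE mulmxKV.
rewrite /closed_loop_A linearB/= trmx_mul !mulmxBl !mulmxBr.
have h1 : G *m C *m P *m (C^T *m G^T) + G *m Q *m G^T = A *m P *m (C^T *m G^T).
  rewrite [RHS]mulmxA -GS /S mulmxDr mulmxDl; congr (_ + _).
  by rewrite !mulmxA.
rewrite {1}e mulmxBr mulmxBl -/S.
have -> : A *m (P *m C^T *m invmx S *m (C *m P)) *m A^T = G *m C *m P *m A^T.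
  by rewrite GE !mulmxA.
rewrite -h1.
move: (A *m P *m A^T) (G *m C *m P *m A^T) (B *m B^T) (G *m C *m P *m _)
  (G *m Q *m G^T) => X1 X2 X3 X4 X5.
by apply/matrixP => i j; rewrite !mxE; ring.
Qed.

(** Continuity lets the recursion started at the identity pass to the limit: this identifies V, then
    the gain and the value of [gamma]. *)
Lemma filter_limitsE c P V G theta : filter_limits A B C D c P V G theta ->
  [/\ riccati_solution A B C D theta P, 0 < theta, c = gamma P theta &
      G = gain_of_riccati A C D theta P].
Proof.
move=> [[hP hV t0 _] [[hric _] hconv]].
have [Pt [Vt [Gt [tt [[_ _ hrec] [cP cV cG ct]]]]]] := hconv 1%:M (pdmx_scalar n ltr01).
have [_ hPi _] := hric.
have cP1 : Pt k.+1 @[k --> \oo] --> P by have := cP; rewrite -cvg_shiftS.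
have cV1 : Vt k.+1 @[k --> \oo] --> V by have := cV; rewrite -cvg_shiftS.
have VE : V = invmx (invmx P - theta%:M).
  have h : Vt k.+1 @[k --> \oo] --> invmx (invmx P - theta%:M).
    have -> : (fun k => Vt k.+1) = (fun k => invmx (invmx (Pt k.+1) - (tt k)%:M)).
      by apply/funext => k; case: (hrec k).
    apply: cvg_invmx; first exact: pdmx_unit.
    apply: cvgB; last exact: cvg_scalar_mx.
    by apply: cvg_invmx => //; exact: pdmx_unit.
  exact: (cvg_unique _ cV1 h).
split => //.
- have h : gamma (Pt k.+1) (tt k) @[k --> \oo] --> gamma P theta.
    have hI : 1%:M - tt k *: Pt k.+1 @[k --> \oo] --> 1%:M - theta *: P.
      by apply: cvgB; [exact: cvg_cst|exact: cvgZ].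
    have pd := risk_pdmx (ltW t0) hPi.
    apply: cvgM; last exact: cvg_cst.
    apply: cvgB; last exact: cvg_cst.
    apply: cvgD; last by apply: cvg_trace; apply: cvg_invmx => //; exact: pdmx_unit.
    have d0 : 0 < \det (1%:M - theta *: P) by case/andP: (pdmx_hadamard pd).
    exact: (continuous_cvg _ (continuous_ln d0) (cvg_det hI)).
  have h2 : gamma (Pt k.+1) (tt k) @[k --> \oo] --> c.
    have -> : (fun k => gamma (Pt k.+1) (tt k)) = fun=> c.
      by apply/funext => k; case: (hrec k) => _ _ [[_ _ <-]].
    exact: cvg_cst.
  exact: (cvg_unique _ h2 h).
- have h : Gt @ \oo --> filter_gain A C D V.
    have -> : Gt = fun k => filter_gain A C D (Vt k).
      by apply/funext => k; case: (hrec k).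
    have hVC : Vt k *m C^T @[k --> \oo] --> V *m C^T.
      by apply: cvg_mulmx => //; exact: cvg_cst.
    apply: cvg_mulmx.
      apply: cvg_mulmx; last exact: cvg_cst.
      by apply: cvg_mulmx => //; exact: cvg_cst.
    apply: cvg_invmx.
      by apply: pdmx_unit; apply: innovation_pdmx; exact: pdmx_psd.
    apply: cvgD; last exact: cvg_cst.
    apply: cvg_mulmx; last exact: cvg_cst.
    by apply: cvg_mulmx => //; exact: cvg_cst.
  by rewrite /gain_of_riccati -VE; exact: (cvg_unique _ cG h).
Qed.

End Filter.

(** * A common [rho] for all small theta *)

Lemma near_within_itv (R : realType) (a : R) (Q : R -> Prop) : 0 < a ->
  (\forall x \near within `[0, a] (nbhs 0), Q x) ->
  exists2 e, 0 < e & forall x, 0 < x -> x < e -> x <= a /\ Q x.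
Proof.
move=> a0 /nbhs_ballP[e /= e0 he]; exists (Num.min e a); first by rewrite lt_min e0.
move=> x x0; rewrite lt_min => /andP[xe xa]; split; first exact: ltW.
apply: he; last by rewrite /= in_itv/= !ltW.
by rewrite /ball/= sub0r normrN gtr0_norm.
Qed.

Lemma exists_uniform_rho (R : realType) (n p : nat)
  (A : 'M[R]_n) (B : 'M[R]_(n, n + p)) (C : 'M[R]_(p, n)) (D : 'M[R]_(p, n + p))
  (thetac : R) (Psol : R -> 'M[R]_n) :
  B *m D^T = 0 -> col_mx B D \in unitmx -> 0 < thetac ->
  closed_loop_continuous A B C D thetac Psol ->
  exists rho e : R, 0 < e /\ forall theta, 0 < theta < e -> theta <= thetac /\
    let G := gain_of_riccati A C D theta (Psol theta) in
    admissible_rho (closed_loop_A A C G) (closed_loop_B B D G) theta rho.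
Proof.
move=> hBD hinv tc0 [hsol hA hB].
pose G t := gain_of_riccati A C D t (Psol t).
pose At t := closed_loop_A A C (G t); pose Bt t := closed_loop_B B D (G t).
have z_in : `[0, thetac]%classic (0 : R) by rewrite /= in_itv/= lexx ltW.
have cA : At @ within `[0, thetac] (nbhs 0) --> At 0.
  by have /subspace_continuousP/(_ _ z_in) := hA.
have cB : Bt @ within `[0, thetac] (nbhs 0) --> Bt 0.
  by have /subspace_continuousP/(_ _ z_in) := hB.
have h0 : riccati_solution A B C D 0 (Psol 0) by apply: hsol; rewrite lexx ltW.
have P0 : pdmx (Psol 0) by case: h0.
have [r r1 hr] := stein_contraction P0 (closed_loop_B_pdmx hBD hinv (G 0))
  (riccati0_stein hBD hinv h0).
(* Three rates 1 < rho < s < r: r holds at theta = 0, s survives for nearby theta, and the gap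
   between rho and s serves to bound [Sigma]. *)
pose s := (1 + r) / 2; pose rho := (1 + s) / 2.
have s1 : 1 < s by rewrite /s; lra.
have sr : 0 < s < r by rewrite /s; apply/andP; split; lra.
have rs : 1 < rho < s by rewrite /rho; apply/andP; split; lra.
have nA := near_contraction cA P0 sr hr.
(* The added 1 leaves room for the variation of Bbar Bbar^T near theta = 0. *)
pose b := abs_sum (Bt 0 *m (Bt 0)^T) + 1.
have b0 : 0 < b by rewrite ltr_wpDl// abs_sum_ge0.
have nB : \forall t \near within `[0, thetac] (nbhs 0),
    loewner_le (Bt t *m (Bt t)^T) b%:M.
  have sym (M : 'M[R]_(n, n + p)) : (b%:M - M *m M^T)^T = b%:M - M *m M^T.
    by rewrite linearB/= tr_scalar_mx trmx_mul trmxK.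
  have pd0 : pdmx (b%:M - Bt 0 *m (Bt 0)^T).
    apply: (@pdmx_le _ _ 1%:M); first exact: pdmx_scalar.
    have sG : (Bt 0 *m (Bt 0)^T)^T = Bt 0 *m (Bt 0)^T by rewrite trmx_mul trmxK.
    have := loewner_le_abs_sum sG; rewrite /loewner_le; congr psdmx.
    by rewrite /b [in RHS]raddfD/= [RHS]addrAC addrK.
  apply: filterS (near_pdmx pd0 (f := fun t => b%:M - Bt t *m (Bt t)^T) _ _).
  - by move=> t; exact: pdmx_psd.
  - apply: cvgB; first exact: cvg_cst.
    by apply: cvg_mulmx => //; exact: cvg_trmx.
  - by move=> t; exact: sym.
(* The weight W, the inverse of [Psol 0], stays fixed while theta varies, so its bounds w and v are
   uniform. *)
have [w w0 hw] := pdmx_lower (pdmx_inv P0).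
have [v v0 hv] := pdmx_lower (pdmx_inv (pdmx_inv P0)).
have [e e0 he] := near_within_itv tc0 (filterI (nA _) nB).
have /andP[rho1 rhos] := rs; have rho0 : 0 < rho by lra.
have s0 : 0 < s by lra.
pose k := (1 - rho ^- 2) * v * ((1 - rho ^+ 2 / s ^+ 2) * w).
have k0 : 0 < k.
  apply: mulr_gt0; apply: mulr_gt0 => //.
    by rewrite subr_gt0 invf_lt1 ?exprn_gt0// exprn_egt1.
  by rewrite subr_gt0 ltr_pdivrMr ?exprn_gt0// mul1r ltr_pXn2r ?nnegrE ?ltW.
exists rho, (Num.min e (k / b)); split; first by rewrite lt_min e0 divr_gt0.
move=> t /andP[t0]; rewrite lt_min => /andP[te tk].
have [ttc [hcA hcB]] := he _ t0 te; split => //=.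
apply: (admissible_of_contraction (pdmx_inv P0) rs hcA w0 hw v0 hv hcB t0).
by rewrite -ler_pdivlMr// ltW.
Qed.

(** * From small tolerances to small theta, and the theorem *)

Theorem proposition3p4 (R : realType) (n p : nat)
  (A : 'M[R]_n) (B : 'M[R]_(n, n + p)) (C : 'M[R]_(p, n)) (D : 'M[R]_(p, n + p))
  (hreach : reachable A B) (hobs : observable A C)
  (hBD : B *m D^T = 0) (hinv : col_mx B D \in unitmx)
  (cMAX : R) (hcMAX : 0 < cMAX)
  (P V : R -> 'M[R]_n) (G : R -> 'M[R]_(n, p)) (theta : R -> R)
  (hlim : forall c : R, 0 < c <= cMAX ->
     filter_limits A B C D c (P c) (V c) (G c) (theta c))
  (thetac : R) (hthetac : 0 < thetac) (Psol : R -> 'M[R]_n)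
  (hcont : closed_loop_continuous A B C D thetac Psol) :
  let Abar c := closed_loop_A A C (G c) in
  let Bbar c := closed_loop_B B D (G c) in
  (exists cbar rho : R, 0 < cbar <= cMAX /\
     forall c : R, 0 < c <= cbar ->
       admissible_rho (Abar c) (Bbar c) (theta c) rho /\
       backward_convergence (Abar c) (Bbar c) (theta c) rho) /\
  (forall c rho : R, 0 < c <= cMAX ->
     admissible_rho (Abar c) (Bbar c) (theta c) rho ->
     backward_convergence (Abar c) (Bbar c) (theta c) rho).
Proof.
move=> Abar Bbar.
have conv c rho : 0 < c <= cMAX -> admissible_rho (Abar c) (Bbar c) (theta c) rho ->
    backward_convergence (Abar c) (Bbar c) (theta c) rho.
  move=> hc; have [_ t0 _ _] := filter_limitsE hinv (hlim _ hc).
  exact: admissible_backward_convergence t0 (closed_loop_B_pdmx hBD hinv _).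
split; last exact: conv.
have [rho [e [e0 he]]] := exists_uniform_rho hBD hinv hthetac hcont.
(* It remains to force theta(c) < e for small c, the range where the common [rho] is admissible. *)
suff [cbar hcbar hsmall] : exists2 cbar : R, 0 < cbar <= cMAX &
    forall c, 0 < c <= cbar -> theta c < e.
  exists cbar, rho; split=> // c /andP[c0 cc].
  have hc : 0 < c <= cMAX by case/andP: hcbar => _; rewrite c0; exact: le_trans.
  have [hric t0 _ GE] := filter_limitsE hinv (hlim _ hc).
  have tlt : theta c < e by apply: hsmall; rewrite c0.
  have [|ttc hadm] := he (theta c); first by rewrite t0.
  suff adm : admissible_rho (Abar c) (Bbar c) (theta c) rho by split=> //; exact: conv.
  have [hsol _ _] := hcont.
  (* Uniqueness of the Riccati solution transfers admissibility from [Psol] to the filter limits. *)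
  have PE : P c = Psol (theta c).
    have [_ [[_ uniqP] _]] := hlim c hc; apply: uniqP; apply: hsol.
    by rewrite (ltW t0).
  by rewrite /Abar /Bbar GE PE.
(* In dimension 0 [gamma] vanishes, contradicting c > 0 at c = [cMAX]. *)
case: (posnP n) => [n0|n_gt0].
  have [_ _ cE _] := filter_limitsE hinv (hlim _ (introT andP (conj hcMAX (lexx _)))).
  have : cMAX = 0.
    rewrite cE /gamma; move: (1%:M - _) => M; clear -n0; subst n.
    by rewrite det_mx00 ln1 /mxtrace big_ord0 !addr0 subr0 mul0r.
  by move=> c0; move: hcMAX; rewrite c0 ltxx.
pose k := Ordinal n_gt0; pose beta := (B *m B^T) k k.
have beta0 : 0 < beta.
  rewrite /beta -bform_delta; apply: pd_bform (state_noise_pdmx hinv) _.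
  apply/eqP => /matrixP/(_ k 0); rewrite !mxE !eqxx => /eqP.
  by rewrite oner_eq0.
pose h := e * beta - ln (1 + e * beta).
have h0 : 0 < h by apply: subr_ln1D_gt0; exact: mulr_gt0.
(* If theta(c) >= e, then [gamma_ge] and P_kk >= beta give 2 c >= h, which c <= h / 4 excludes. *)
exists (Num.min cMAX (h / 4)).
  by rewrite ge_min lexx lt_min hcMAX divr_gt0.
move=> c /andP[c0]; rewrite le_min => /andP[cM ch].
have hc : 0 < c <= cMAX by rewrite c0.
have [hric t0 cE _] := filter_limitsE hinv (hlim _ hc).
rewrite ltNge; apply/negP => et; have [hP hV _] := hric.
have hb : beta <= P c k k.
  by rewrite /beta -!bform_delta; exact: loewner_le_bform (riccati_ge hinv hric).
have := gamma_ge hP (ltW t0) hV k; rewrite -cE.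
have ebP : e * beta <= theta c * P c k k by apply: ler_pM => //; exact: ltW.
have := subr_ln1D_mono (ltW (mulr_gt0 e0 beta0)) ebP.
rewrite -/h; lra.
Qed.
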